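(* Let $(M,\omega)$ be a multisymplectic manifold of order $k$ (that is, $\omega$ is a closed, possibly degenerate, $(k+1)$-form on $M$) and let $i:N\hookrightarrow M$ be a $k$-coisotropic submanifold. Then $$\widehat I_N:=\{\widehat\alpha\in\widehat\Omega^{k-1}_H(M):\ i^*d\alpha=0\}$$ is a subalgebra of the Lie algebra $(\widehat\Omega^{k-1}_H(M),\{\cdot,\cdot\}^\bullet)$.
   Context: For $x\in N$, put $(T_xN)^{\perp,k}=\{v\in T_xM:\omega_x(v,w_1,\dots,w_k)=0\ \forall w_1,\dots,w_k\in T_xN\}$ and $\ker\flat_1|_x=\{v\in T_xM:\iota_v\omega_x=0\}$. $N$ is $k$-coisotropic if $(T_xN)^{\perp,k}\subseteq T_xN+\ker\flat_1|_x$ for every $x\in N$. A $(k-1)$-form $\alpha$ on $M$ is Hamiltonian if there is a vector field $X_\alpha$ on $M$ with $\iota_{X_\alpha}\omega=d\alpha$. $\Omega^{k-1}_H(M)$ denotes the space of Hamiltonian $(k-1)$-forms, $Z^{k-1}(M)$ the space of closed $(k-1)$-forms, $\widehat\Omega^{k-1}_H(M)=\Omega^{k-1}_H(M)/Z^{k-1}(M)$, and $\widehat\alpha$ the class of $\alpha$. (The condition $i^*d\alpha=0$ depends only on the class.) The bracket on $\widehat\Omega^{k-1}_H(M)$ is $\{\widehat\alpha,\widehat\beta\}^\bullet=-\widehat{\iota_{X_\alpha\wedge X_\beta}\omega}$, where $\iota_{X_\alpha}\omega=d\alpha$, $\iota_{X_\beta}\omega=d\beta$ and $\iota_{X\wedge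 Y}\omega=\omega(X,Y,\cdot,\dots,\cdot)$. It is well defined (independent of the choices of $X_\alpha,X_\beta$ and representatives) and is a Lie bracket. *)

(* Defs.v *)
From HB Require Import structures.
From mathcomp Require Import all_boot all_order all_algebra.
From mathcomp Require Import all_classical all_reals all_analysis.

Set Implicit Arguments.
Unset Strict Implicit.
Unset Printing Implicit Defensive.

Import Order.TTheory GRing.Theory Num.Theory.
Import numFieldNormedType.Exports.

Local Open Scope classical_set_scope.
Local Open Scope ring_scope.

Section Smooth.
Variables (R : realType) (V W : normedModType R).

Fixpoint times_differentiable (r : nat) (U : set V) (f : V -> W) : Prop :=
  if r is s.+1 then
    (forall x, U x -> differentiable f x) /\
    (forall v, times_differentiable s U (fun x => 'D_v f x))
  else True.

(* Meant for open U and finite-dimensional V, where it says that f is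
   infinitely often Frechet differentiable on U. *)
Definition smooth_on (U : set V) (f : V -> W) : Prop :=
  forall r, times_differentiable r U f.

End Smooth.

(* A chart is a pair (chart a, chart_inv a) of total functions, meaningful on
   dom a and on its image only.  The atlas need not be maximal. *)
Structure manifold (R : realType) (n : nat) := Manifold {
  point :> topologicalType;
  point_hausdorff : hausdorff_space point;
  point_second_countable : @second_countable point;
  atlas : Type;
  dom : atlas -> set point;
  chart : atlas -> point -> 'rV[R]_n;
  chart_inv : atlas -> 'rV[R]_n -> point;
  dom_open : forall a, open (dom a);
  codom_open : forall a, open (chart a @` dom a);
  chartK : forall a x, dom a x -> chart_inv a (chart a x) = x;
  chart_continuous :
    forall a x, dom a x -> {for x, continuous (chart a)};
  chart_inv_continuous :
    forall a u, (chart a @` dom a) u -> {for u, continuous (chart_inv a)};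
  transition_smooth : forall a b,
    smooth_on (chart a @` (dom a `&` dom b)) (chart b \o chart_inv a);
  chart_at : point -> atlas;
  chart_atP : forall x, dom (chart_at x) x
}.

(* The tangent space at x is 'rV[R]_n for every x: the vector v stands for the
   tangent vector at x whose coordinates in the chart chart_at x are v.
   Coordinates in any other chart are obtained with the differential of the
   transition map. *)

Section Tensors.
Variables (R : realType) (n : nat) (M : manifold R n).

Definition base (x : M) : 'rV[R]_n := chart (chart_at x) x.

Definition to_chart (a : atlas M) (x : M) (v : 'rV[R]_n) : 'rV[R]_n :=
  'd (chart a \o chart_inv (chart_at x)) (base x) v.

Definition of_chart (a : atlas M) (x : M) (v : 'rV[R]_n) : 'rV[R]_n :=
  'd (chart (chart_at x) \o chart_inv a) (chart a x) v.

Definition smooth_field (X : M -> 'rV[R]_n) : Prop :=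
  forall a, smooth_on (chart a @` dom a)
    (fun u => to_chart a (chart_inv a u) (X (chart_inv a u))).

(* At each point, a scalar function of p tangent vectors: no multilinearity or
   smoothness is assumed here, see is_form. *)
Definition tensor (p : nat) : Type := M -> ('I_p -> 'rV[R]_n) -> R.

HB.instance Definition _ p := GRing.Lmodule.copy (tensor p)
  (M -> ('I_p -> 'rV[R]_n) -> R).

Definition multilinear p (f : ('I_p -> 'rV[R]_n) -> R) : Prop :=
  forall (i : 'I_p) (v : 'I_p -> 'rV[R]_n) (c : R) (u w : 'rV[R]_n),
    f [eta v with i |-> c *: u + w] =
    c * f [eta v with i |-> u] + f [eta v with i |-> w].

Definition alternating p (f : ('I_p -> 'rV[R]_n) -> R) : Prop :=
  forall (v : 'I_p -> 'rV[R]_n) (i j : 'I_p),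
    i != j -> v i = v j -> f v = 0.

Definition in_chart p (alpha : tensor p) (a : atlas M)
    (u : 'rV[R]_n) (w : 'I_p -> 'rV[R]_n) : R :=
  alpha (chart_inv a u) (fun i => of_chart a (chart_inv a u) (w i)).

Definition is_form p (alpha : tensor p) : Prop :=
  [/\ forall x, multilinear (alpha x),
      forall x, alternating (alpha x) &
      forall a w, smooth_on (chart a @` dom a)
        (fun u => in_chart alpha a u w)].

(* d (f dx^I) = df /\ dx^I in the chart chart_at x, evaluated at x, with the
   normalization (dx^1 /\ dx^2)(e_1, e_2) = 1. *)
Definition ext_d p (alpha : tensor p) : tensor p.+1 := fun x v =>
  \sum_(i < p.+1) (-1) ^+ i *
    'D_(v i) (fun u => in_chart alpha (chart_at x) u (fun j => v (lift i j)))
      (base x).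

Definition tcons p (v : 'rV[R]_n) (w : 'I_p -> 'rV[R]_n) :
    'I_p.+1 -> 'rV[R]_n :=
  fun i => if unlift ord0 i is Some j then w j else v.

Definition contract p (X : M -> 'rV[R]_n) (alpha : tensor p.+1) : tensor p :=
  fun x w => alpha x (tcons (X x) w).

Definition contract2 p (X Y : M -> 'rV[R]_n) (alpha : tensor p.+2) :
    tensor p := fun x w => alpha x (tcons (X x) (tcons (Y x) w)).

Definition closed_forms p : set (tensor p) :=
  [set alpha | is_form alpha /\ ext_d alpha = 0].

Lemma ext_dD q (alpha beta : tensor q) : is_form alpha -> is_form beta ->
  ext_d (alpha + beta) = ext_d alpha + ext_d beta.
Proof.
move=> [_ _ sa] [_ _ sb]; apply/funext => x; apply/funext => v.
rewrite /ext_d !addrfctE -big_split /=; apply: eq_bigr => j _.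
rewrite -mulrDr; congr (_ * _).
have xD : (chart (chart_at x) @` dom (chart_at x)) (base x).
  by exists x => //; exact: chart_atP.
rewrite -deriveD; first by [].
  by have [+ _] := sa (chart_at x) (fun i => v (lift j i)) 1%N;
    move=> /(_ _ xD)/diff_derivable; exact.
by have [+ _] := sb (chart_at x) (fun i => v (lift j i)) 1%N;
  move=> /(_ _ xD)/diff_derivable; exact.
Qed.

Lemma closed_forms0 q : closed_forms (0 : tensor q).
Proof.
have in0 a w : (fun u => in_chart (0 : tensor q) a u w) = cst 0 by [].
split; last first.
  apply/funext => x; apply/funext => v; rewrite /ext_d big1// => j _.
  by rewrite in0 derive_cst mulr0.
split=> [x i v c u w|x v i j _ _ //|a w r]; first by rewrite mulr0 addr0.
rewrite in0; elim: r => //= r IH; split=> [x _|v]; first exact: differentiable_cst.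
by rewrite [X in times_differentiable _ _ X](_ : _ = cst 0) //;
  apply/funext => x; rewrite derive_cst.
Qed.

Lemma contract2C q (X Y : M -> 'rV[R]_n) (alpha : tensor q.+2) :
  is_form alpha -> contract2 Y X alpha = - contract2 X Y alpha.
Proof.
move=> [lin alt _]; apply/funext => x; apply/funext => w; apply/eqP.
rewrite -addr_eq0 /contract2.
pose g a b := alpha x (tcons a (tcons b w)).
have g_l a a' b : g (a + a') b = g a b + g a' b.
  have := lin x ord0 (tcons a (tcons b w)) 1 a a'; rewrite scale1r mul1r.
  have E c : [eta tcons a (tcons b w) with ord0 |-> c] = tcons c (tcons b w)
      :> ('I_q.+2 -> 'rV[R]_n).
    by apply/funext => j; rewrite /tcons /=; case: unliftP => [j' ->|->].
  by rewrite !E.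
have g_r a b b' : g a (b + b') = g a b + g a b'.
  have := lin x (lift ord0 ord0) (tcons a (tcons b w)) 1 b b'.
  rewrite scale1r mul1r.
  have E c : [eta tcons a (tcons b w) with lift ord0 ord0 |-> c] =
      tcons a (tcons c w) :> ('I_q.+2 -> 'rV[R]_n).
    apply/funext => j; rewrite /tcons /=; case: (unliftP ord0 j) => [j' ->|->//].
    rewrite (inj_eq lift_inj); case: (unliftP ord0 j') => [j'' ->|->].
      by rewrite eq_sym (negbTE (neq_lift _ _)).
    by rewrite eqxx.
  by rewrite !E.
have g_alt a : g a a = 0.
  apply: (alt x _ ord0 (lift ord0 ord0)); first exact: neq_lift.
  by rewrite /tcons unlift_none liftK unlift_none.
apply/eqP; have := g_alt (X x + Y x).
by rewrite g_l !g_r !g_alt add0r addr0 addrC.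
Qed.

Definition multisymplectic k (omega : tensor k.+1) : Prop :=
  is_form omega /\ ext_d omega = 0.

End Tensors.
Arguments closed_forms {R n} M p.

Section Maps.
Variables (R : realType) (n m : nat) (N : manifold R n) (M : manifold R m).

Definition smooth_map (f : N -> M) : Prop :=
  continuous f /\
  forall a b, smooth_on (chart a @` (dom a `&` f @^-1` dom b))
    (chart b \o f \o chart_inv a).

Definition differential (f : N -> M) (y : N) (v : 'rV[R]_n) : 'rV[R]_m :=
  'd (chart (chart_at (f y)) \o f \o chart_inv (chart_at y)) (base y) v.

Definition pullback p (f : N -> M) (alpha : tensor M p) : tensor N p :=
  fun y w => alpha (f y) (fun j => differential f y (w j)).

(* Immersed submanifolds; embedded ones are those for which i is moreover a
   homeomorphism onto its image. *)
Definition submanifold (i : N -> M) : Prop :=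
  [/\ smooth_map i, injective i & forall y, injective (differential i y)].

Definition tangent_image (i : N -> M) (y : N) : set 'rV[R]_m :=
  range (differential i y).

Definition orthogonal_at k (omega : tensor M k.+1) (x : M)
    (T : set 'rV[R]_m) : set 'rV[R]_m :=
  [set v | forall w : 'I_k -> 'rV[R]_m,
     (forall j, T (w j)) -> omega x (tcons v w) = 0].

Definition flat_kernel k (omega : tensor M k.+1) (x : M) : set 'rV[R]_m :=
  [set v | forall w : 'I_k -> 'rV[R]_m, omega x (tcons v w) = 0].

Definition coisotropic k (omega : tensor M k.+1) (i : N -> M) : Prop :=
  forall y : N,
    orthogonal_at omega (i y) (tangent_image i y) `<=`
    [set t + c | t in tangent_image i y & c in flat_kernel omega (i y)].

End Maps.

(* The order of omega is k = p.+1, so that omega has degree k + 1 = p.+2 and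
   Hamiltonian forms have degree k - 1 = p. *)
Section Hamiltonian.
Variables (R : realType) (n p : nat) (M : manifold R n).
Variable omega : tensor M p.+2.

Definition hamiltonian_field (alpha : tensor M p) (X : M -> 'rV[R]_n) : Prop :=
  smooth_field X /\ contract X omega = ext_d alpha.

Definition hamiltonian_forms : set (tensor M p) :=
  [set alpha | is_form alpha /\ exists X, hamiltonian_field alpha X].

(* The quotient by closed forms is realized as a set of cosets. *)
Definition hat (alpha : tensor M p) : set (tensor M p) :=
  [set alpha + z | z in closed_forms M p].

Definition hat_hamiltonian : set (set (tensor M p)) :=
  [set hat alpha | alpha in hamiltonian_forms].

Definition hat_add (A B : set (tensor M p)) : set (tensor M p) :=
  [set alpha + beta | alpha in A & beta in B].

Definition hat_scale (c : R) (A : set (tensor M p)) : set (tensor M p) :=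
  [set c *: alpha + z | alpha in A & z in closed_forms M p].

(* Taken as the union of the cosets given by all choices of representatives
   and of Hamiltonian vector fields; for A and B in hat_hamiltonian these
   cosets exist and coincide (hat_bracketE). *)
Definition hat_bracket (A B : set (tensor M p)) : set (tensor M p) :=
  [set gamma | exists alpha beta X Y,
     [/\ A alpha, B beta, hamiltonian_field alpha X,
         hamiltonian_field beta Y & hat (- contract2 X Y omega) gamma]].

Lemma hat_bracketE (alpha beta : tensor M p) (X Y : M -> 'rV[R]_n) :
  is_form omega -> is_form alpha -> is_form beta ->
  hamiltonian_field alpha X -> hamiltonian_field beta Y ->
  hat_bracket (hat alpha) (hat beta) = hat (- contract2 X Y omega).
Proof.
move=> fo fa fb hX hY.
have hatI gamma : hat gamma gamma.
  by exists 0; [exact: closed_forms0|rewrite addr0].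
have dhat gamma gamma' : is_form gamma -> hat gamma gamma' ->
    ext_d gamma' = ext_d gamma.
  by move=> fg [z [fz dz] <-]; rewrite ext_dD// dz addr0.
apply/seteqP; split=> [gamma|gamma hg]; last first.
  by exists alpha, beta, X, Y; split.
move=> [a [b [X' [Y' [ha hb [_ hX'] [_ hY'] hg]]]]].
suff <- : contract2 X' Y' omega = contract2 X Y omega by [].
have c2 U V V' : contract V omega = contract V' omega ->
    contract2 V U omega = contract2 V' U omega.
  move=> e; apply/funext => x; apply/funext => w.
  by have := congr1 (fun f : tensor M p.+1 => f x (tcons (U x) w)) e.
have eX : contract X' omega = contract X omega.
  by rewrite hX' hX.2; exact: dhat.
have eY : contract Y' omega = contract Y omega.
  by rewrite hY' hY.2; exact: dhat.
by rewrite (c2 _ _ _ eX) contract2C// (c2 _ _ _ eY) -contract2C.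
Qed.

Definition lie_subalgebra (I : set (set (tensor M p))) : Prop :=
  [/\ I `<=` hat_hamiltonian,
      I (hat 0),
      forall A B, I A -> I B -> I (hat_add A B),
      forall c A, I A -> I (hat_scale c A) &
      forall A B, I A -> I B -> I (hat_bracket A B)].

Definition hat_vanishing (m : nat) (N : manifold R m) (i : N -> M) :
    set (set (tensor M p)) :=
  [set hat alpha | alpha in
     [set alpha | hamiltonian_forms alpha /\ pullback i (ext_d alpha) = 0]].

End Hamiltonian.

(* Main.v *)
Require Import Defs.
From HB Require Import structures.
From mathcomp Require Import all_boot all_order all_algebra.
From mathcomp Require Import all_classical all_reals all_analysis.
From mathcomp Require Import zify ring.

(* If dF = iota_X omega and dG = iota_Y omega, then omega, dF and dG are
   closed, so Cartan's formula gives L_X omega = L_Y omega = 0 and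
   d (iota_X iota_Y omega) = iota_[X, Y] omega: the bracket is Hamiltonian.
   If moreover i^*dF = i^*dG = 0, then along N both X and Y lie in the
   k-orthogonal of TN, so coisotropy lets X be replaced by a vector t of TN
   without changing iota_X omega; hence
   i^*omega(X, Y, ...) = - i^*omega(Y, t, ...) = - i^*dG(t, ...) = 0, and its
   exterior derivative vanishes because i^* commutes with d.  Independence of
   the chart, both for d and for [X, Y], rests on the symmetry of second
   derivatives. *)

Set Implicit Arguments.
Unset Strict Implicit.
Unset Printing Implicit Defensive.

Import Order.TTheory GRing.Theory Num.Theory.
Import numFieldNormedType.Exports.

Local Open Scope classical_set_scope.
Local Open Scope ring_scope.

(** Tangent vectors at [x] are read in [chart_at x], and this chart may jump from point to point.
    Hence [ext_d alpha] and the bracket of two fields, both given pointwise, cannot be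
    differentiated before they are rewritten in one fixed chart near the point; this obstacle shapes
    the proof. The calculus is done for families of multilinear functions on coordinate space and
    carried to [M] by invariance under transition maps. A transition map is the local expression of
    the identity, so this invariance and the compatibility of d with i^* are two instances of one
    naturality statement. Its second-derivative terms and those of d d cancel by the same
    alternating double sum. On the algebraic side, classes are sets of forms, and each closure
    property is reduced to a single representative. *)

(** * Symmetry of second derivatives *)

Section Schwarz.
Variables (R : realType) (V : normedModType R) (f : V -> R) (x : V).

Lemma derivable_line (y v : V) (s : R) : differentiable f (y + s *: v) ->
  is_derive s (1 : R) (fun t : R => f (y + t *: v)) ('D_v f (y + s *: v)).
Proof.
move=> df.
have E : (fun h : R => h^-1 *: (((fun t : R => f (y + t *: v)) \o shift s)
      (h *: (1 : R)) - f (y + s *: v)))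
   = (fun h : R => h^-1 *: ((f \o shift (y + s *: v)) (h *: v) - f (y + s *: v))).
  apply/funext => h /=; congr (_ *: (f _ - _)).
  by rewrite [h *: 1]mulr1 scalerDl addrCA.
by split; rewrite /derivable /derive E //; exact/diff_derivable.
Qed.

(** The mean value theorem, applied in direction [v], turns the second difference into [h] times an
    increment of ['D_v f], which the differentiability of ['D_v f] at [x] evaluates up to [e]. The
    increment runs between the offsets c v and c v + h w with 0 <= c <= h, whence the weight 2|v| +
    |w|. *)
Lemma second_difference (v w : V) :
  (\forall y \near x, differentiable f y) -> differentiable ('D_v f) x ->
  forall e : R, 0 < e -> \forall h \near 0^'+,
   `|f (x + h *: w + h *: v) - f (x + h *: w) - f (x + h *: v) + f x -
     h ^+ 2 * 'D_w ('D_v f) x| <= e * h ^+ 2 * (`|v| *+ 2 + `|w|).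
Proof.
move=> df dDf e e0.
have : \forall y \near 0, `|'D_v f (x + y) - 'D_v f x - 'd ('D_v f) x y| <= e * `|y|.
  have /eqaddoP/(_ _ e0) := diff_locally dDf.
  by apply: filterS => y /=; rewrite /cst opprD addrA -[(_ - _) y]/(_ - _) (addrC x).
move=> /nbhs_ballP[d1 /= d10 Hd1].
have /nbhs_ballP[d2 /= d20 Hd2] := df.
near=> h.
have h0 : 0 < h by near: h; exact: nbhs_right_gt.
have small c b : 0 <= c <= h -> 0 <= b <= h ->
    `|c *: v + b *: w| < Num.min d1 d2.
  move=> /andP[c0 ch] /andP[b0 bh].
  apply: (@le_lt_trans _ _ (h * (`|v| + `|w|))).
    rewrite (le_trans (ler_normD _ _))// mulrDr !normrZ !ger0_norm//.
    by rewrite lerD// ler_wpM2r.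
  (* The added 1 keeps the divisor positive even if [v] and [w] both vanish. *)
  apply: (@le_lt_trans _ _ (h * (`|v| + `|w| + 1))).
    by rewrite ler_pM2l// lerDl.
  rewrite -ltr_pdivlMr; last by rewrite ltr_wpDl.
  near: h; apply: nbhs_right_lt.
  by rewrite divr_gt0 ?lt_min ?d10// ltr_wpDl.
have diffx c b : 0 <= c <= h -> 0 <= b <= h ->
    differentiable f (x + b *: w + c *: v).
  move=> ch bh; apply: Hd2; rewrite -ball_normE /= -addrA opprD addNKr normrN addrC.
  by have := small _ _ ch bh; rewrite lt_min => /andP[].
have approx c b : 0 <= c <= h -> 0 <= b <= h ->
    `|'D_v f (x + (c *: v + b *: w)) - 'D_v f x - 'd ('D_v f) x (c *: v + b *: w)| <=
    e * `|c *: v + b *: w|.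
  move=> ch bh; apply: Hd1; rewrite -ball_normE /= sub0r normrN.
  by have := small _ _ ch bh; rewrite lt_min => /andP[].
have hh : 0 <= h <= h by rewrite lexx ltW.
have h00 : 0 <= (0 : R) <= h by rewrite lexx ltW.
(* The term [0 *: w] gives both summands the shape of [diffx], with [b = h] and with [b = 0]. *)
pose g s := f (x + h *: w + s *: v) - f (x + 0 *: w + s *: v).
pose g' s := 'D_v f (x + h *: w + s *: v) - 'D_v f (x + 0 *: w + s *: v).
have gd s : 0 <= s <= h -> is_derive s (1 : R) g (g' s).
  by move=> sh; apply: is_deriveB; apply: derivable_line; exact: diffx.
have [c ch Hc] : exists2 c, c \in `]0, h[%R & g h - g 0 = g' c * (h - 0).
  apply: MVT => //.
    by move=> s; rewrite in_itv/= => /andP[s0 sh]; apply: gd; rewrite !ltW.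
  apply: derivable_within_continuous => s.
  by rewrite in_itv /= => /gd[].
have {}ch : 0 <= c <= h by move: ch; rewrite in_itv /= => /andP[? ?]; rewrite !ltW.
have -> : f (x + h *: w + h *: v) - f (x + h *: w) - f (x + h *: v) + f x = g h - g 0.
  rewrite /g !scale0r !addr0; ring.
have A1 := approx c h ch hh; have A2 := approx c 0 ch h00.
rewrite Hc subr0 deriveE//.
have -> : g' c * h - h ^+ 2 * 'd ('D_v f) x w =
  h * (('D_v f (x + (c *: v + h *: w)) - 'D_v f x - 'd ('D_v f) x (c *: v + h *: w))
   - ('D_v f (x + (c *: v + 0 *: w)) - 'D_v f x - 'd ('D_v f) x (c *: v + 0 *: w))).
  have dZ a b : 'd ('D_v f) x (a *: v + b *: w) =
      a * 'd ('D_v f) x v + b * 'd ('D_v f) x w.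
    by rewrite linearD !linearZ.
  rewrite !dZ /g' -!addrA !(addrC (c *: v)); ring.
rewrite normrM (gtr0_norm h0) expr2.
have -> : e * (h * h) * (`|v| *+ 2 + `|w|) =
    h * (e * ((h * `|v| + h * `|w|) + (h * `|v|))) by ring.
rewrite ler_pM2l// (le_trans (ler_normB _ _))// mulrDr lerD//.
  apply: (le_trans A1); rewrite ler_pM2l// (le_trans (ler_normD _ _))// !normrZ.
  case/andP: ch => c0 ch; rewrite !ger0_norm ?(ltW h0)//.
  by rewrite lerD// ler_wpM2r.
apply: (le_trans A2); rewrite ler_pM2l// scale0r addr0 normrZ.
by case/andP: ch => c0 ch; rewrite ger0_norm// ler_wpM2r.
Unshelve. all: by end_near. Qed.

(** The second difference is symmetric in [v] and [w], so both mixed derivatives approximate the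
    same quantity over [h ^+ 2]. *)
Lemma derive_comm (v w : V) :
  (\forall y \near x, differentiable f y) ->
  differentiable ('D_v f) x -> differentiable ('D_w f) x ->
  'D_v ('D_w f) x = 'D_w ('D_v f) x.
Proof.
move=> df dv dw; apply/eqP; rewrite -subr_eq0 -normr_le0; apply/ler_addgt0Pl => e e0.
rewrite addr0.
(* The two error weights add up to 3|v| + 3|w|; the extra 1 makes [K] positive. *)
pose K := `|v| *+ 3 + `|w| *+ 3 + 1.
have K0 : 0 < K by rewrite ltr_wpDl// addr_ge0// mulrn_wge0.
have eK : 0 < e / K by rewrite divr_gt0.
near (0:R)^'+ => h.
have h0 : 0 < h by near: h; exact: nbhs_right_gt.
have H1 : `|f (x + h *: w + h *: v) - f (x + h *: w) - f (x + h *: v) + f x -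
     h ^+ 2 * 'D_w ('D_v f) x| <= e / K * h ^+ 2 * (`|v| *+ 2 + `|w|).
  by near: h; exact: second_difference.
have H2 : `|f (x + h *: v + h *: w) - f (x + h *: v) - f (x + h *: w) + f x -
     h ^+ 2 * 'D_v ('D_w f) x| <= e / K * h ^+ 2 * (`|w| *+ 2 + `|v|).
  by near: h; exact: second_difference.
rewrite -(@ler_pM2l _ (h ^+ 2)) ?exprn_gt0//.
rewrite -[X in X * `|_|]gtr0_norm ?exprn_gt0// -normrM.
set Delta := (f _ - _ - _ + _) in H1.
set D1 := 'D_w _ _ in H1 *; set D2 := 'D_v ('D_w _) _ in H2 *.
have -> : h ^+ 2 * (D2 - D1) = (Delta - h ^+ 2 * D1) -
   (f (x + h *: v + h *: w) - f (x + h *: v) - f (x + h *: w) + f x - h ^+ 2 * D2).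
  by rewrite /Delta (addrAC x); ring.
rewrite (le_trans (ler_normB _ _))// (le_trans (lerD H1 H2))//.
rewrite -mulrDr [X in X <= _](_ : _ = h ^+ 2 * (e / K * (K - 1))); last first.
  by rewrite /K; field; rewrite -/K gt_eqF.
rewrite ler_pM2l ?exprn_gt0// -mulrA ger_pMr// ler_pdivrMl// mulr1.
by rewrite lerBlDr lerDl.
Unshelve. all: by end_near. Qed.

End Schwarz.

(** * Smooth functions on an open set *)

Section NearEq.
Variables (R : realType) (V W : normedModType R).

Lemma near_eq_differentiable (f g : V -> W) x : (\near x, f x = g x) ->
  differentiable f x -> differentiable g x /\ 'd g x = 'd f x :> (V -> W).
Proof.
move=> fg df.
have fgx : f x = g x by exact: nbhs_singleton fg.
have E : g \o shift x = cst (g x) + 'd f x +o_ 0 id.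
  apply/eqaddoP => e e0; have /eqaddoP/(_ e e0) := diff_locally df.
  have fg0 : \forall y \near 0, f (y + x) = g (y + x).
    by have := fg; rewrite (near_shift 0) /=; apply: filterS => y /=; rewrite subr0.
  by apply: filterS2 fg0 => y /= Ey; rewrite /shift -fgx /= !fctE /= -Ey.
have dE := diff_unique (diff_continuous df) E.
split; last exact: dE.
by apply/diff_locallyP; rewrite dE; split => //; exact: diff_continuous.
Qed.

Lemma differentiable_is_derive (f : V -> W) x v :
  differentiable f x -> is_derive x v f ('D_v f x).
Proof. by move=> df; exact/derivableP/diff_derivable. Qed.

End NearEq.

Section SmoothOn.
Variables (R : realType) (V : normedModType R) (U : set V).
Hypothesis Uo : open U.
Implicit Types W : normedModType R.

Lemma smooth_on_differentiable W (f : V -> W) x :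
  smooth_on U f -> U x -> differentiable f x.
Proof. by move=> /(_ 1%N)[+ _]; exact. Qed.

Lemma smooth_on_derive W (f : V -> W) v : smooth_on U f -> smooth_on U ('D_v f).
Proof. by move=> sf r; have [_] := sf r.+1; exact. Qed.

Lemma eq_on_near W (f g : V -> W) x : {in U, f =1 g} -> U x -> \near x, f x = g x.
Proof.
move=> fg Ux; near=> y; apply: fg; rewrite inE; near: y.
exact: open_nbhs_nbhs.
Unshelve. all: by end_near. Qed.

(** Functions read in charts are total and arbitrary outside [U]. Since [U] is open, agreement on
    [U] is agreement near each of its points, which is all that a derivative sees. *)
Lemma eq_times_differentiable W r (f g : V -> W) : {in U, f =1 g} ->
  times_differentiable r U f -> times_differentiable r U g.
Proof.
elim: r f g => // r IH f g fg [df dDf]; split=> [x Ux|v].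
  by have [] := near_eq_differentiable (eq_on_near fg Ux) (df _ Ux).
apply: IH (dDf v) => x; rewrite inE => Ux.
exact: near_eq_derive (eq_on_near fg Ux).
Qed.

Lemma eq_smooth_on W (f g : V -> W) : {in U, f =1 g} ->
  smooth_on U f -> smooth_on U g.
Proof. by move=> fg sf r; exact: eq_times_differentiable fg (sf r). Qed.

Lemma smooth_on_cst W (c : W) : smooth_on U (cst c).
Proof.
move=> r; elim: r c => //= r IH c; split=> [x _|v]; first exact: differentiable_cst.
by rewrite [X in times_differentiable _ _ X](_ : _ = cst 0) //;
  apply/funext => x; rewrite derive_cst.
Qed.

(** Kept at a fixed order because the induction in [smooth_onM] controls the two summands of a
    derivative only up to order [r]. *)
Lemma times_differentiableD W r (f g : V -> W) :
  times_differentiable r U f -> times_differentiable r U g ->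
  times_differentiable r U (f + g).
Proof.
elim: r f g => // r IH f g [df dDf] [dg dDg]; split=> [x Ux|v].
  by apply: differentiableD; [exact: df|exact: dg].
apply: eq_times_differentiable (IH _ _ (dDf v) (dDg v)) => x; rewrite inE => Ux.
by rewrite deriveD //; apply: diff_derivable; [exact: df|exact: dg].
Qed.

Lemma smooth_onD W (f g : V -> W) :
  smooth_on U f -> smooth_on U g -> smooth_on U (f + g).
Proof. by move=> sf sg r; exact: times_differentiableD. Qed.

Lemma smooth_onZ W (c : R) (f : V -> W) : smooth_on U f -> smooth_on U (c *: f).
Proof.
move=> sf r; elim: r f sf => // r IH f sf; split=> [x Ux|v].
  by apply: differentiableZ; exact: smooth_on_differentiable sf Ux.
apply: eq_times_differentiable (IH _ (smooth_on_derive v sf)) => x.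
rewrite inE => Ux; rewrite deriveZ //.
exact: diff_derivable (smooth_on_differentiable sf Ux).
Qed.

Lemma smooth_on_sum W n (f : 'I_n -> V -> W) :
  (forall j, smooth_on U (f j)) -> smooth_on U (fun y => \sum_j f j y).
Proof.
move=> sf; rewrite (_ : (fun y => _) = \sum_j f j); last first.
  by apply/funext => y; rewrite fct_sumE.
by elim/big_ind : _ => [|g h|j _]; [exact: smooth_on_cst|exact: smooth_onD|].
Qed.

Lemma differentiable_scale W (f : V -> R) (c : W) x :
  differentiable f x -> differentiable (fun y => f y *: c) x.
Proof. by move=> df; exact: differentiableZl. Qed.

Lemma is_derive_scale W (f : V -> R) (c : W) x v (df : R) :
  is_derive x v f df -> is_derive x v (fun y => f y *: c) (df *: c).
Proof.
move=> [dv <-].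
have H : h^-1 *: (((fun y => f y *: c) \o shift x) (h *: v) - f x *: c) @[h --> 0^'] -->
    'D_v f x *: c.
  rewrite (_ : (fun h => _) = (fun h => (h^-1 *: ((f \o shift x) (h *: v) - f x)) *: c)).
    exact: cvgZr_tmp.
  by apply/funext => h /=; rewrite -scalerBl scalerA.
by split; [apply/cvg_ex; eexists; exact: H|exact: cvg_lim H].
Qed.

Lemma smooth_on_scale W (f : V -> R) (c : W) :
  smooth_on U f -> smooth_on U (fun y => f y *: c).
Proof.
move=> sf r; elim: r f sf => // r IH f sf; split=> [x Ux|v].
  by apply: differentiable_scale; exact: smooth_on_differentiable sf Ux.
apply: eq_times_differentiable (IH _ (smooth_on_derive v sf)) => x.
rewrite inE => Ux; apply/esym.
have /differentiable_is_derive-/(_ v) := smooth_on_differentiable sf Ux.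
by move=> /(is_derive_scale c)[].
Qed.

(** Induction on the order over all pairs of smooth factors: by the Leibniz rule a derivative of the
    product is a sum of two such products. *)
Lemma smooth_onM (f g : V -> R) :
  smooth_on U f -> smooth_on U g -> smooth_on U (f * g).
Proof.
move=> sf sg r; elim: r f g sf sg => // r IH f g sf sg; split=> [x Ux|v].
  by apply: differentiableM; exact: smooth_on_differentiable Ux.
apply: eq_times_differentiable (times_differentiableD
  (IH _ _ sf (smooth_on_derive v sg)) (IH _ _ sg (smooth_on_derive v sf))) => x.
rewrite inE => Ux; rewrite deriveM //.
  exact: diff_derivable (smooth_on_differentiable sf Ux).
exact: diff_derivable (smooth_on_differentiable sg Ux).
Qed.

Lemma is_derive_coord n (f : V -> 'rV[R]_n) x v df j : is_derive x v f df ->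
  is_derive x v (fun y => f y 0 j : R) (df 0 j).
Proof.
move=> [dv <-]; split; first exact: (derivable_mxP _ _ _).1 dv 0 j.
by rewrite (derive_mx dv) mxE.
Qed.

Lemma is_derive_rV n (f : V -> 'rV[R]_n) x v (df : 'rV[R]_n) :
  (forall j, is_derive x v (fun y => f y 0 j : R) (df 0 j)) -> is_derive x v f df.
Proof.
move=> H; have dv : derivable f x v.
  by apply/derivable_mxP => i j; rewrite ord1; have [] := H j.
split=> //; rewrite (derive_mx dv); apply/rowP => j; rewrite mxE.
by have [] := H j.
Qed.

Lemma smooth_on_coord n (f : V -> 'rV[R]_n) j : smooth_on U f ->
  smooth_on U (fun y => f y 0 j : R).
Proof.
move=> sf r; elim: r f sf => // r IH f sf; split=> [x Ux|v].
  have df := smooth_on_differentiable sf Ux.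
  exact: (differentiable_comp df (differentiable_coord _ _ _)).
apply: eq_times_differentiable (IH _ (smooth_on_derive v sf)) => x.
rewrite inE => Ux.
have /differentiable_is_derive-/(_ v) := smooth_on_differentiable sf Ux.
by move=> /(is_derive_coord j)[_ ->].
Qed.

Lemma smooth_on_comb n (f : V -> 'rV[R]_n) (g : 'I_n -> V -> R) :
  smooth_on U f -> (forall j, smooth_on U (g j)) ->
  smooth_on U (fun y => \sum_j f y 0 j * g j y).
Proof.
move=> sf sg; apply: smooth_on_sum => j.
exact: smooth_onM (smooth_on_coord j sf) (sg j).
Qed.

Lemma smooth_on_rV n (f : V -> 'rV[R]_n) :
  (forall j, smooth_on U (fun y => f y 0 j : R)) -> smooth_on U f.
Proof.
move=> sf.
rewrite (_ : f = fun y => \sum_j f y 0 j *: delta_mx 0 j); last first.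
  by apply/funext => y; rewrite {1}(row_sum_delta (f y)).
by apply: smooth_on_sum => j; exact: smooth_on_scale.
Qed.

Lemma smooth_derive_comm (f : V -> R) x v w : smooth_on U f -> U x ->
  'D_v ('D_w f) x = 'D_w ('D_v f) x.
Proof.
move=> sf Ux; apply: derive_comm.
- near=> y; apply: smooth_on_differentiable sf _; near: y.
  exact: open_nbhs_nbhs.
- exact: smooth_on_differentiable (smooth_on_derive _ sf) Ux.
- exact: smooth_on_differentiable (smooth_on_derive _ sf) Ux.
Unshelve. all: by end_near. Qed.

(** The mean value theorem behind [derive_comm] concerns real values, so the vector case goes
    through the coordinates. *)
Lemma smooth_derive_comm_rV n (f : V -> 'rV[R]_n) x v w : smooth_on U f -> U x ->
  'D_v ('D_w f) x = 'D_w ('D_v f) x.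
Proof.
move=> sf Ux; apply/rowP => j.
have coordD (g : V -> 'rV[R]_n) y z : smooth_on U g -> U y ->
    ('D_z g y) 0 j = 'D_z (fun y => g y 0 j : R) y.
  move=> sg Uy.
  have /differentiable_is_derive-/(_ z) := smooth_on_differentiable sg Uy.
  by move=> /(is_derive_coord j)[].
have coordDD y z : ('D_y ('D_z f) x) 0 j = 'D_y ('D_z (fun y => f y 0 j : R)) x.
  rewrite coordD //; last exact: smooth_on_derive.
  apply: near_eq_derive; near=> t; apply: coordD => //; near: t.
  exact: open_nbhs_nbhs.
have sj := smooth_on_coord j sf.
have C := smooth_derive_comm v w sj Ux.
exact: (etrans (coordDD v w) (etrans C (esym (coordDD w v)))).
Unshelve. all: by end_near. Qed.

End SmoothOn.

(** * Multilinear and alternating functions *)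

Section Multilinear.
Variables (R : realType) (n : nat).
Local Notation V := 'rV[R]_n.

Lemma linear_expand (f : V -> R) : (forall c u w, f (c *: u + w) = c * f u + f w) ->
  forall z, f z = \sum_j z 0 j * f (delta_mx 0 j).
Proof.
move=> lf z; have f0 : f 0 = 0.
  by have := lf (-1) 0 0; rewrite scaler0 addr0 mulN1r addNr.
rewrite {1}(row_sum_delta z); elim/big_rec2 : _ => // j a b _ <-.
exact: lf.
Qed.

Lemma tcons_eta p (v : 'I_p.+1 -> V) : v = tcons (v ord0) (fun j => v (lift ord0 j)).
Proof. by apply/funext => j; rewrite /tcons; case: unliftP => [k|] ->. Qed.

Lemma tcons0 p (a : V) (w : 'I_p -> V) : tcons a w ord0 = a.
Proof. by rewrite /tcons unlift_none. Qed.

Lemma tconsS p (a : V) (w : 'I_p -> V) j : tcons a w (lift ord0 j) = w j.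
Proof. by rewrite /tcons liftK. Qed.

Lemma tcons_upd0 p (a b : V) (w : 'I_p -> V) :
  [eta tcons a w with ord0 |-> b] = tcons b w :> ('I_p.+1 -> V).
Proof. by apply/funext => j; rewrite /tcons /=; case: unliftP => [k ->|->]. Qed.

Lemma tcons_updS p (a b : V) (w : 'I_p -> V) k :
  [eta tcons a w with lift ord0 k |-> b] =
  tcons a [eta w with k |-> b] :> ('I_p.+1 -> V).
Proof.
apply/funext => j; rewrite /tcons /=; case: (unliftP ord0 j) => [i|] ->.
  by rewrite (inj_eq lift_inj).
by [].
Qed.

Lemma multilinear_head p (f : ('I_p.+1 -> V) -> R) w : multilinear f ->
  forall c u z, f (tcons (c *: u + z) w) = c * f (tcons u w) + f (tcons z w).
Proof.
by move=> lf c u z; have := lf ord0 (tcons 0 w) c u z; rewrite !tcons_upd0.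
Qed.

Lemma multilinear_tail p (f : ('I_p.+1 -> V) -> R) a : multilinear f ->
  multilinear (fun w => f (tcons a w)).
Proof.
move=> lf i v c u w; have := lf (lift ord0 i) (tcons a v) c u w.
by rewrite !tcons_updS.
Qed.

Lemma alternating_tail p (f : ('I_p.+1 -> V) -> R) a : Defs.alternating f ->
  Defs.alternating (fun w => f (tcons a w)).
Proof.
move=> af v i j ij vij; apply: (af _ (lift ord0 i) (lift ord0 j)).
  by rewrite (inj_eq lift_inj).
by rewrite !tconsS.
Qed.

Lemma multilinear0 p (f : ('I_p -> V) -> R) i w : multilinear f ->
  f [eta w with i |-> 0] = 0.
Proof.
by move=> lf; have := lf i w (-1) 0 0; rewrite scaler0 addr0 mulN1r addNr.
Qed.

(** Polarization: expand the vanishing value of [f] with [a + b] in both slots. *)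
Lemma alternating_swap p (f : ('I_p -> V) -> R) i j a b w :
  multilinear f -> Defs.alternating f -> i != j ->
  f [eta w with i |-> a, j |-> b] = - f [eta w with i |-> b, j |-> a].
Proof.
move=> lf af ij.
pose g c d := f [eta w with i |-> c, j |-> d].
have gl c c' d : g (c + c') d = g c d + g c' d.
  have E z : [eta w with i |-> z, j |-> d] =
      [eta [eta w with j |-> d] with i |-> z] :> ('I_p -> V) by [].
  have := lf i [eta w with j |-> d] 1 c c'.
  by rewrite scale1r mul1r /g !E.
have gr c d d' : g c (d + d') = g c d + g c d'.
  have E z : [eta w with i |-> c, j |-> z] =
      [eta [eta w with i |-> c] with j |-> z] :> ('I_p -> V).
    apply/funext => k /=; case: (eqVneq k i) => [->|//].
    by rewrite (negbTE ij).
  have := lf j [eta w with i |-> c] 1 d d'.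
  by rewrite scale1r mul1r /g !E.
have g0 c : g c c = 0.
  by apply: (af _ i j ij); rewrite /= eqxx eq_sym (negbTE ij) eqxx.
apply/eqP; rewrite -addr_eq0; apply/eqP.
by have := g0 (a + b); rewrite gl !gr !g0 add0r addr0.
Qed.

(** The vector [s] travels from slot [j] to the front by [j] adjacent transpositions. *)
Lemma alternating_front p (f : ('I_p.+1 -> V) -> R) (j : 'I_p.+1) s v :
  multilinear f -> Defs.alternating f ->
  f [eta v with j |-> s] = (-1) ^+ j * f (tcons s (fun k => v (lift j k))).
Proof.
move=> lf af; case: j => j; elim: j v => [|j IH] v jp.
  rewrite expr0 mul1r; congr f.
  rewrite [LHS]tcons_eta /=; congr tcons.
have jp' : (j < p.+1)%N by exact: ltnW.
pose i := Ordinal jp'; pose i' := Ordinal jp.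
have ii' : i != i' by rewrite -val_eqE /= neq_ltn ltnSn.
(* Writing out the entry already in slot [i] lets [alternating_swap] exchange it with [s]. *)
have -> : [eta v with i' |-> s] = [eta v with i |-> v i, i' |-> s] :> ('I_p.+1 -> V).
  by apply/funext => k /=; case: (eqVneq k i) => [->|//]; rewrite (negbTE ii').
rewrite alternating_swap//.
have -> : [eta v with i |-> s, i' |-> v i] =
    [eta [eta v with i' |-> v i] with i |-> s] :> ('I_p.+1 -> V) by [].
rewrite IH exprS mulN1r mulNr; congr (- (_ * f (tcons s _))).
(* After the exchange [v i] sits in slot [i'], so dropping slot [i] leaves the same vectors as
   dropping slot [i'] from [v]. *)
apply/funext => k /=.
case: (eqVneq (lift i k) i') => [e|ne].
  congr v; apply/val_inj => /=; move/(congr1 val): e => /=.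
  rewrite /bump; case: (leqP j k) => jk /=; rewrite ?add1n ?add0n.
    by case=> ->; rewrite ltnn.
  by move=> e; move: jk; rewrite e ltnNge leqnSn.
congr v; apply/val_inj => /=; move: ne; rewrite -val_eqE /= /bump.
case: (ltngtP j k) => jk //=; rewrite ?add1n ?add0n //.
by rewrite jk eqxx.
Qed.

End Multilinear.

(** * Cancellation in alternating double sums *)

Section DoubleSum.
Variables (R : pzRingType) (p : nat).

(** The cosimplicial identity for [lift]; [inord i] is the index [i] in the ordinal one size
    smaller. *)
Lemma lift_lift_exchange (i : 'I_p.+2) (j : 'I_p.+1) : (i <= j)%N ->
  [/\ lift i j = j.+1 :> nat, lift (lift i j) (inord i : 'I_p.+1) = i &
   forall k : 'I_p, lift (lift i j) (lift (inord i) k) = lift i (lift j k)].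
Proof.
move=> ij; have ip : (i < p.+1)%N by rewrite (leq_ltn_trans ij).
have E : lift i j = j.+1 :> nat by rewrite /= /bump ij.
split=> // [|k]; apply/val_inj; rewrite /= inordK // /bump ij add1n.
  by rewrite ltnNge ij.
have := ij; move: (nat_of_ord i) (nat_of_ord j) (nat_of_ord k) => a b c ab.
case: (leqP b c) => bc; case: (leqP a c) => ac; rewrite ?add0n ?add1n; lia.
Qed.

(** The map (i, j) to (j + 1, i) matches the pairs with i <= j with those with i > j; it preserves
    [f] and reverses the sign. In the proof it is [h], with inverse [h']. *)
Lemma alternating_double_sum (f : 'I_p.+2 -> 'I_p.+1 -> R) :
  (forall (i : 'I_p.+2) (j : 'I_p.+1), (i <= j)%N ->
    f (lift i j) (inord i) = f i j) ->
  \sum_(i < p.+2) \sum_(j < p.+1) (-1) ^+ i * ((-1) ^+ j * f i j) = 0.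
Proof.
move=> fC; rewrite pair_big /= (bigID (fun q : 'I_p.+2 * 'I_p.+1 => (q.1 <= q.2)%N)) /=.
pose h (q : 'I_p.+2 * 'I_p.+1) : 'I_p.+2 * 'I_p.+1 := (lift q.1 q.2, inord q.1).
pose h' (q : 'I_p.+2 * 'I_p.+1) : 'I_p.+2 * 'I_p.+1 :=
  (widen_ord (leqnSn _) q.2, inord q.1.-1).
rewrite [X in _ + X](reindex_onto h h') /=; last first.
  move=> [i j] /=; rewrite -ltnNge => ji; rewrite /h /h' /=.
  have ip : (i.-1 < p.+1)%N by have := ltn_ord i; case: (nat_of_ord i) ji.
  congr pair; apply/val_inj; rewrite /= ?inordK //.
  by rewrite /bump; case: (nat_of_ord i) ji ip => // i' /=; rewrite ltnS => ->.
rewrite [X in _ + X](eq_bigl (fun q : 'I_p.+2 * 'I_p.+1 => (q.1 <= q.2)%N)); last first.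
  move=> [i j] /=; apply/andP/idP => [[]|ij].
    rewrite -ltnNge /bump => H /eqP [/(congr1 val) /=].
    case: (leqP i j) H => // ji; rewrite add0n => H.
    by move=> e _; move: H; rewrite e => /ltn_trans/(_ ji); rewrite ltnn.
  have [E _ _] := lift_lift_exchange ij.
  have ip : (i < p.+1)%N by rewrite (leq_ltn_trans ij).
  rewrite /bump ij add1n inordK // -ltnNge ltnS ij; split => //; apply/eqP; rewrite /h' /h.
  congr pair; apply/val_inj => /=; first by rewrite inordK.
  by rewrite /bump ij add1n /= inord_val.
rewrite -big_split /= big1 // => -[i j] /= ij.
have [_ _ _] := lift_lift_exchange ij.
have ip : (i < p.+1)%N by rewrite (leq_ltn_trans ij).
rewrite fC // /bump ij inordK // add1n exprS mulN1r !mulNr.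
by rewrite mulrA -exprD addnC exprD -mulrA subrr.
Qed.

(** Common source of d d = 0 and of the naturality of d: in both, second derivatives enter
    symmetrically in two of the vectors. *)
Lemma symmetric_double_sum W (f : W -> W -> ('I_p -> W) -> R) (w : 'I_p.+2 -> W) :
  (forall a b c, f a b c = f b a c) ->
  \sum_(i < p.+2) \sum_(j < p.+1) (-1) ^+ i * ((-1) ^+ j *
    f (w i) (w (lift i j)) (fun k => w (lift i (lift j k)))) = 0.
Proof.
move=> fC; apply: (alternating_double_sum
  (f := fun (i : 'I_p.+2) (j : 'I_p.+1) =>
    f (w i) (w (lift i j)) (fun k => w (lift i (lift j k))))) => i j ij.
have [_ E H] := lift_lift_exchange ij.
by rewrite E fC; congr f; apply/funext => k; rewrite H.
Qed.

End DoubleSum.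

(** * Product rules for multilinear expressions *)

Section Leibniz.
Variables (R : realType) (X : normedModType R).

(** Expanding the vector in the standard basis leaves finitely many products of real functions, so
    [L] has to be differentiated at fixed vectors only. *)
Lemma is_derive_app n (L : X -> 'rV[R]_n -> R) (dL : 'rV[R]_n -> R) g dg x v :
  (forall y c u w, L y (c *: u + w) = c * L y u + L y w) ->
  (forall z, is_derive x v (L^~ z) (dL z)) -> is_derive x v g dg ->
  is_derive x v (fun y => L y (g y)) (dL (g x) + L x dg).
Proof.
move=> lL dLx dgx.
have H (h : X -> 'rV[R]_n) dh : is_derive x v h dh ->
  is_derive x v (fun y => L y (h y))
    (\sum_j (h x 0 j * dL (delta_mx 0 j) + L x (delta_mx 0 j) * dh 0 j)).
  move=> dhx.
  rewrite (_ : (fun y => _) =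
      \sum_j ((fun y => h y 0 j : R) * (fun y => L y (delta_mx 0 j)))); last first.
    by apply/funext => y; rewrite fct_sumE (linear_expand (lL y)).
  by apply: is_derive_sum => j; apply: is_deriveM; exact: is_derive_coord.
(* [H] with a constant vector, together with uniqueness of derivatives, shows that [dL] is
   linear. *)
have dLE z : dL z = \sum_j z 0 j * dL (delta_mx 0 j).
  have [_ <-] := dLx z; have [_ ->] := H _ _ (is_derive_cst z x v).
  by apply: eq_bigr => j _; rewrite mxE mulr0 addr0.
apply: is_derive_eq (H _ _ dgx) _; rewrite big_split /= -dLE; congr (_ + _).
rewrite (linear_expand (lL x)); apply: eq_bigr => j _; exact: mulrC.
Qed.

(** Induction on the number of slots: [is_derive_app] handles the first one, the induction
    hypothesis the others. *)
Lemma is_derive_multilinear n p (A : X -> ('I_p -> 'rV[R]_n) -> R)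
    (dA : ('I_p -> 'rV[R]_n) -> R) (g : 'I_p -> X -> 'rV[R]_n) dg x v :
  (forall y, multilinear (A y)) ->
  (forall w, is_derive x v (A^~ w) (dA w)) ->
  (forall j, is_derive x v (g j) (dg j)) ->
  is_derive x v (fun y => A y (fun j => g j y))
    (dA (fun j => g j x) +
     \sum_j A x [eta (fun j => g j x) with j |-> dg j]).
Proof.
elim: p A dA g dg => [|p IH] A dA g dg lA dAx dgx.
  rewrite big_ord0 addr0.
  rewrite (_ : (fun y => _) = A^~ (fun j => g j x)) //.
  by apply/funext => y; congr (A y); apply/funext => -[].
have E y : (fun j => g j y) = tcons (g ord0 y) (fun j => g (lift ord0 j) y).
  exact: tcons_eta.
under [X in is_derive _ _ X _]funext do rewrite E.
pose L y z := A y (tcons z (fun j => g (lift ord0 j) y)).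
have := @is_derive_app n L (fun z => dA (tcons z (fun j => g (lift ord0 j) x)) +
   \sum_j A x (tcons z [eta (fun j => g (lift ord0 j) x) with j |-> dg (lift ord0 j)]))
   (g ord0) (dg ord0) x v.
move=> /(_ (fun y => multilinear_head _ (lA y))) H.
apply: is_derive_eq.
  apply: H => // z.
  apply: (IH (fun y w => A y (tcons z w)) (fun w => dA (tcons z w))) => // y.
  exact: multilinear_tail.
rewrite -addrA -E; congr (_ + _); rewrite big_ord_recl addrC; congr (_ + _).
  by rewrite E tcons_upd0.
by apply: eq_bigr => j _; rewrite E tcons_updS.
Qed.

Lemma is_derive_comp n (W : normedModType R) (f : X -> 'rV[R]_n) (h : 'rV[R]_n -> W) x v :
  differentiable f x -> differentiable h (f x) ->
  is_derive x v (fun y => h (f y)) ('D_('d f x v) h (f x)).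
Proof.
move=> df dh; have dhf := differentiable_comp df dh.
apply: is_derive_eq (differentiable_is_derive v dhf) _.
by rewrite !deriveE // diff_comp.
Qed.

End Leibniz.

(** * Exterior calculus in coordinates *)

Section LocalForms.
Variables (R : realType) (n : nat).
Local Notation V := 'rV[R]_n.

(** [ext_d alpha x] is, by conversion, this operator applied to [in_chart alpha (chart_at x)] at
    [base x]. *)
Definition local_d p (A : V -> ('I_p -> V) -> R) (u : V) (w : 'I_p.+1 -> V) : R :=
  \sum_(i < p.+1) (-1) ^+ i * 'D_(w i) (A^~ (fun j => w (lift i j))) u.

Definition local_contract p (X : V -> V) (A : V -> ('I_p.+1 -> V) -> R)
  (u : V) (w : 'I_p -> V) : R := A u (tcons (X u) w).

Lemma eq_local_d p (A B : V -> ('I_p -> V) -> R) u w :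
  (\near u, forall w, A u w = B u w) -> local_d A u w = local_d B u w.
Proof.
move=> AB; apply: eq_bigr => i _; congr (_ * _); apply: near_eq_derive.
by apply: filterS AB => y.
Qed.

Lemma local_d_local_d p (A : V -> ('I_p -> V) -> R) (U : set V) u w :
  open U -> U u -> (forall w, smooth_on U (A^~ w)) -> local_d (local_d A) u w = 0.
Proof.
move=> Uo Uu sA.
rewrite -[RHS](symmetric_double_sum
  (f := fun a b c => 'D_a ('D_b (A^~ c)) u) w); last first.
  by move=> a b c; exact: (smooth_derive_comm Uo _ _ (sA c) Uu).
apply: eq_bigr => i _; rewrite -mulr_sumr; congr (_ * _).
have dD (j : 'I_p.+1) :
    is_derive u (w i) ((-1) ^+ j *: 'D_(w (lift i j)) (A^~ (fun k => w (lift i (lift j k)))))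
     ((-1) ^+ j *: 'D_(w i) ('D_(w (lift i j)) (A^~ (fun k => w (lift i (lift j k))))) u).
  apply: is_deriveZ; apply: differentiable_is_derive.
  exact: (smooth_on_differentiable (smooth_on_derive _ (sA _)) Uu).
have [_ <-] := is_derive_sum dD.
by congr ('D_(w i) _ u); apply/funext => y; rewrite fct_sumE.
Qed.

Lemma is_derive_local_contract p (X : V -> V) (A : V -> ('I_p.+1 -> V) -> R) u v w dX dA :
  (forall y, multilinear (A y)) ->
  (forall w, is_derive u v (A^~ w) (dA w)) -> is_derive u v X dX ->
  is_derive u v ((local_contract X A)^~ w) (dA (tcons (X u) w) + A u (tcons dX w)).
Proof.
move=> lA dAu dXu.
apply: (is_derive_app (L := fun y z => A y (tcons z w))
  (dL := fun z => dA (tcons z w))) => // y.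
exact: (multilinear_head _ (lA y)).
Qed.

Lemma tcons_lift p (a : V) (w : 'I_p.+1 -> V) i :
  (fun j => tcons a w (lift (lift ord0 i) j)) = tcons a (fun j => w (lift i j)).
Proof.
apply/funext => j; case: (unliftP ord0 j) => [k|] ->.
  rewrite tconsS -[RHS](tconsS a w); congr (tcons a w).
  by apply/val_inj; rewrite /= /bump /= !add1n ltnS addnS.
rewrite tcons0 -[RHS](tcons0 a w); congr (tcons a w).
by apply/val_inj; rewrite /= /bump.
Qed.

(* Cartan's formula: the right-hand side is the Lie derivative of [A] along
   [X], with [D X (w i)] moved to the first place. *)
Lemma cartan p (X : V -> V) (A : V -> ('I_p.+1 -> V) -> R) u w :
  (forall y, multilinear (A y)) ->
  (forall v w, derivable (A^~ w) u v) -> (forall v, derivable X u v) ->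
  local_d (local_contract X A) u w + local_d A u (tcons (X u) w) =
  'D_(X u) (A^~ w) u +
  \sum_(i < p.+1) (-1) ^+ i * A u (tcons ('D_(w i) X u) (fun j => w (lift i j))).
Proof.
move=> lA dA dX; rewrite {2}/local_d big_ord_recl expr0 mul1r tcons0.
rewrite [Z in 'D_(X u) Z u](_ : _ = A^~ w); last first.
  by apply/funext => y; congr A; apply/funext => j; rewrite tconsS.
rewrite addrCA; congr (_ + _); rewrite -big_split; apply: eq_bigr => i _ /=.
rewrite tconsS tcons_lift /bump add1n exprS mulN1r mulNr -mulrBr; congr (_ * _).
have [_ ->] := is_derive_local_contract (fun j => w (lift i j)) lA
  (fun w' => derivableP (dA (w i) w')) (derivableP (dX (w i))).
by rewrite addrAC subrr add0r.
Qed.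

Lemma alternating_swap0 p (f : ('I_p.+2 -> V) -> R) a b w :
  multilinear f -> Defs.alternating f ->
  f (tcons a (tcons b w)) = - f (tcons b (tcons a w)).
Proof.
move=> lf af.
have E c d : [eta tcons a (tcons b w) with ord0 |-> c, lift ord0 ord0 |-> d] =
    tcons c (tcons d w) :> ('I_p.+2 -> V).
  have -> : [eta tcons a (tcons b w) with ord0 |-> c, lift ord0 ord0 |-> d] =
    [eta [eta tcons a (tcons b w) with lift ord0 ord0 |-> d] with ord0 |-> c]
     :> ('I_p.+2 -> V) by [].
  by rewrite tcons_updS tcons_upd0 tcons_upd0.
by have := @alternating_swap _ _ _ f ord0 (lift ord0 ord0) a b (tcons a (tcons b w)) lf af isT;
  rewrite !E.
Qed.

Definition local_bracket (X Y : V -> V) (u : V) : V :=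
  'D_(X u) Y u - 'D_(Y u) X u.

(** This is L_X iota_Y - iota_Y L_X = iota_[X, Y] with L_X A = 0. Cartan's formula along [X] is used
    for [local_contract Y A] on [w] and for [A] on [Y u] followed by [w]; the difference of the two
    leaves only the bracket term. *)
Lemma local_d_contract2 p (X Y : V -> V) (A : V -> ('I_p.+2 -> V) -> R) u w :
  (forall y, multilinear (A y)) -> Defs.alternating (A u) ->
  (forall v w, derivable (A^~ w) u v) ->
  (forall v, derivable X u v) -> (forall v, derivable Y u v) ->
  (forall w, local_d A u w = 0) ->
  (forall w, local_d (local_contract X A) u w = 0) ->
  (forall w, local_d (local_contract Y A) u w = 0) ->
  local_d (local_contract X (local_contract Y A)) u w =
  A u (tcons (local_bracket X Y u) w).
Proof.
move=> lA aA dA dX dY A0 XA0 YA0.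
have lYA y : multilinear (local_contract Y A y) by exact: multilinear_tail.
have dYA v w' : is_derive u v ((local_contract Y A)^~ w')
    ('D_v (A^~ (tcons (Y u) w')) u + A u (tcons ('D_v Y u) w')).
  exact: (is_derive_local_contract w' lA (fun z => derivableP (dA v z)) (derivableP (dY v))).
have := cartan w lYA (fun v w' => ex_derive (is_derive := dYA v w')) dX.
rewrite YA0 addr0 => ->.
have := cartan (tcons (Y u) w) lA dA dX.
rewrite XA0 A0 addr0 big_ord_recl expr0 mul1r tcons0.
rewrite (_ : (fun j => tcons (Y u) w (lift ord0 j)) = w); last first.
  by apply/funext => j; rewrite tconsS.
have [_ ->] := dYA (X u) w.
set S1 := \sum_i _; set S2 := \sum_i _.
(* In [S2] the vector [Y u] precedes [w] and shifts the index by one; exchanging it with the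
   derivative of [X] gives a second sign that compensates. *)
have -> : S2 = S1.
  apply: eq_bigr => i _; rewrite /local_contract tconsS tcons_lift.
  by rewrite alternating_swap0 // mulrN -mulNr /= /bump add1n exprS mulN1r.
rewrite /local_bracket.
have -> : A u (tcons ('D_(X u) Y u - 'D_(Y u) X u) w) =
    A u (tcons ('D_(X u) Y u) w) - A u (tcons ('D_(Y u) X u) w).
  by rewrite addrC -scaleN1r (multilinear_head _ (lA u)) mulN1r addrC.
by move=> /esym H; apply/eqP; rewrite -subr_eq0 -[X in _ == X]H; apply/eqP; ring.
Qed.

Lemma derive_expand m (Y : V -> 'rV[R]_m) u v : differentiable Y u ->
  'D_v Y u = \sum_j v 0 j *: 'D_(delta_mx 0 j) Y u.
Proof.
move=> dY; rewrite deriveE // {1}(row_sum_delta v) linear_sum.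
by apply: eq_bigr => j _; rewrite linearZ deriveE.
Qed.

(** [smooth_on] controls derivatives in fixed directions, so the varying direction is expanded in
    the standard basis. *)
Lemma smooth_on_derive_field (U : set V) m (X : V -> V) (Y : V -> 'rV[R]_m) : open U ->
  smooth_on U X -> smooth_on U Y -> smooth_on U (fun u => 'D_(X u) Y u).
Proof.
move=> Uo sX sY; apply: smooth_on_rV => // k.
apply: (@eq_smooth_on _ _ _ Uo _ (fun u => \sum_j X u 0 j * ('D_(delta_mx 0 j) Y u) 0 k)).
  move=> u; rewrite inE => Uu.
  rewrite (derive_expand _ (smooth_on_differentiable sY Uu)) summxE.
  by apply: eq_bigr => j _; rewrite mxE.
apply: smooth_on_comb => // j.
exact: (smooth_on_coord Uo k (smooth_on_derive _ sY)).
Qed.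

Lemma smooth_on_local_bracket (U : set V) (X Y : V -> V) : open U ->
  smooth_on U X -> smooth_on U Y -> smooth_on U (local_bracket X Y).
Proof.
move=> Uo sX sY.
rewrite (_ : local_bracket X Y = (fun u => 'D_(X u) Y u) + (-1) *: (fun u => 'D_(Y u) X u)).
  apply: smooth_onD => //; first exact: smooth_on_derive_field.
  exact: smooth_onZ (smooth_on_derive_field Uo sY sX).
by apply/funext => u; rewrite /local_bracket !fctE scaleN1r.
Qed.

End LocalForms.

(** * Naturality of the exterior derivative and of the bracket *)

Section Naturality.
Variables (R : realType) (n m : nat).
Variables (F : 'rV[R]_n -> 'rV[R]_m) (U : set 'rV[R]_n) (u : 'rV[R]_n).
Hypotheses (Uo : open U) (sF : smooth_on U F) (Uu : U u).

Lemma is_derive_diff z v :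
  is_derive u v (fun y => 'd F y z) ('D_v ('D_z F) u).
Proof.
apply: (@near_eq_is_derive _ _ _ ('D_z F)).
  near=> y; rewrite deriveE //; apply: smooth_on_differentiable sF _; near: y.
  exact: open_nbhs_nbhs.
apply: differentiable_is_derive.
exact: smooth_on_differentiable (smooth_on_derive _ sF) Uu.
Unshelve. all: by end_near. Qed.

Let dF : differentiable F u := smooth_on_differentiable sF Uu.

(** Besides the pulled back derivative of [A], the product rule gives terms in which one slot
    carries a second derivative of [F]. These are symmetric in the two directions and cancel in the
    alternating sum. *)
Lemma local_d_pullback p (A : 'rV[R]_m -> ('I_p -> 'rV[R]_m) -> R) w :
  (forall y, multilinear (A y)) -> Defs.alternating (A (F u)) ->
  (forall w, differentiable (A^~ w) (F u)) ->
  local_d (fun y w => A (F y) (fun j => 'd F y (w j))) u w =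
  local_d A (F u) (fun j => 'd F u (w j)).
Proof.
move=> lA aA dA.
have D (i : 'I_p.+1) : 'D_(w i) (fun y => A (F y) (fun j => 'd F y (w (lift i j)))) u =
  'D_('d F u (w i)) (A^~ (fun j => 'd F u (w (lift i j)))) (F u) +
  \sum_(j < p) A (F u) [eta (fun j => 'd F u (w (lift i j))) with j |->
     'D_(w i) ('D_(w (lift i j)) F) u].
  have [_ ->] // := @is_derive_multilinear _ _ _ _ (fun y => A (F y))
   (fun w' => 'D_('d F u (w i)) (A^~ w') (F u)) (fun j y => 'd F y (w (lift i j)))
   (fun j => 'D_(w i) ('D_(w (lift i j)) F) u) u (w i) (fun y => lA (F y))
   (fun w' => is_derive_comp (w i) dF (dA w')) (fun j => is_derive_diff _ _).
apply: etrans.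
  apply: eq_bigr => i _.
  exact: (etrans (congr1 (fun t => (-1) ^+ i * t) (D i)) (mulrDr _ _ _)).
rewrite big_split /= -[RHS]addr0; congr (_ + _).
(* A form of degree 0 has no slot, hence no second-derivative terms; [symmetric_double_sum] covers
   the other degrees. *)
case: p A w lA aA dA {D} => [|p] A w lA aA dA.
  by rewrite big1 // => i _; rewrite big_ord0 mulr0.
rewrite -[RHS](symmetric_double_sum (f := fun a b c =>
   A (F u) (tcons ('D_a ('D_b F) u) (fun k => 'd F u (c k)))) w).
  apply: eq_bigr => i _; rewrite -mulr_sumr; congr (_ * _).
  (* Bringing the second derivative from slot [j] to the front produces the inner sign of the double
     sum. *)
  by apply: eq_bigr => j _; rewrite alternating_front.
by move=> a b c; rewrite (smooth_derive_comm_rV Uo a b sF Uu).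
Qed.

Lemma derive_related (X : 'rV[R]_n -> 'rV[R]_n) (X' : 'rV[R]_m -> 'rV[R]_m) v :
  (forall y, U y -> X' (F y) = 'd F y (X y)) ->
  differentiable X u -> differentiable X' (F u) ->
  'D_('d F u v) X' (F u) = 'D_v ('D_(X u) F) u + 'd F u ('D_v X u).
Proof.
move=> XX' dX dX'.
have [_ <-] := is_derive_comp v dF dX'.
have [] // := @is_derive_rV R _ m (fun y => X' (F y)) u v
  ('D_v ('D_(X u) F) u + 'd F u ('D_v X u)) _.
move=> j; rewrite mxE.
apply: (@near_eq_is_derive _ _ _ (fun y => ('d F y (X y)) 0 j)).
  near=> y; rewrite XX' //; near: y; exact: open_nbhs_nbhs.
apply: (is_derive_app (L := fun y z => ('d F y z) 0 j)
  (dL := fun z => ('D_v ('D_z F) u) 0 j)).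
- by move=> y c a b; rewrite linearP !mxE.
- by move=> z; apply: is_derive_coord; exact: is_derive_diff.
- exact: differentiable_is_derive.
Unshelve. all: by end_near. Qed.

(** Each of the two derivatives carries a second derivative of [F] along [X] and [Y]; by symmetry
    these cancel in the bracket. *)
Lemma local_bracket_related (X Y : 'rV[R]_n -> 'rV[R]_n) (X' Y' : 'rV[R]_m -> 'rV[R]_m) :
  (forall y, U y -> X' (F y) = 'd F y (X y)) ->
  (forall y, U y -> Y' (F y) = 'd F y (Y y)) ->
  differentiable X u -> differentiable Y u ->
  differentiable X' (F u) -> differentiable Y' (F u) ->
  local_bracket X' Y' (F u) = 'd F u (local_bracket X Y u).
Proof.
move=> XX' YY' dX dY dX' dY'; rewrite /local_bracket XX' // YY' //.
rewrite (derive_related _ YY') // (derive_related _ XX') //.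
rewrite (smooth_derive_comm_rV Uo (Y u) (X u) sF Uu) linearB.
by rewrite opprD addrACA subrr add0r.
Qed.

End Naturality.

(** * Charts, local expressions and tangent vectors *)

Section Charts.
Variables (R : realType) (n : nat) (M : manifold R n).

Lemma chart_invK (a : atlas M) u : (chart a @` dom a) u ->
  dom a (chart_inv a u) /\ chart a (chart_inv a u) = u.
Proof. by case=> x ax <-; rewrite chartK. Qed.

End Charts.

Section LocalExpression.
Variables (R : realType) (n m : nat) (N : manifold R n) (M : manifold R m).

(** With [f := idfun] this is a transition map, so changes of chart need no separate treatment. *)
Definition local_expr (f : N -> M) (a : atlas N) (b : atlas M) :
  'rV[R]_n -> 'rV[R]_m := chart b \o f \o chart_inv a.

Definition local_dom (f : N -> M) (a : atlas N) (b : atlas M) :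
  set 'rV[R]_n := chart a @` (dom a `&` f @^-1` dom b).

Lemma local_domP f (a : atlas N) (b : atlas M) u : local_dom f a b u ->
  [/\ dom a (chart_inv a u), dom b (f (chart_inv a u)) & chart a (chart_inv a u) = u].
Proof. by case=> x [ax bx] <-; rewrite chartK. Qed.

Lemma local_dom_chart f (a : atlas N) (b : atlas M) x : dom a x -> dom b (f x) ->
  local_dom f a b (chart a x).
Proof. by move=> ax bx; exists x. Qed.

Lemma local_expr_chart f (a : atlas N) (b : atlas M) x : dom a x ->
  local_expr f a b (chart a x) = chart b (f x).
Proof. by move=> ax; rewrite /local_expr /= chartK. Qed.

Lemma local_dom_open f (a : atlas N) (b : atlas M) : continuous f -> open (local_dom f a b).
Proof.
move=> cf; rewrite openE => _ [x [ax bx] <-].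
have au : (chart a @` dom a) (chart a x) by exists x.
have U1 : nbhs (chart a x) (chart a @` dom a).
  by apply: open_nbhs_nbhs; split => //; exact: codom_open.
have U2 : nbhs (chart a x) (chart_inv a @^-1` (f @^-1` dom b)).
  apply: (chart_inv_continuous au); rewrite chartK //.
  by apply: cf; apply: open_nbhs_nbhs; split => //; exact: dom_open.
apply: filterS2 U1 U2 => u /chart_invK[au' uE] bu.
by exists (chart_inv a u).
Qed.

Lemma smooth_local_expr f (a : atlas N) (b : atlas M) : smooth_map f ->
  smooth_on (local_dom f a b) (local_expr f a b).
Proof. by move=> [_]; exact. Qed.

Lemma differentiable_local_expr f (a : atlas N) (b : atlas M) x : smooth_map f ->
  dom a x -> dom b (f x) -> differentiable (local_expr f a b) (chart a x).
Proof.
move=> sf ax bx; apply: smooth_on_differentiable (smooth_local_expr a b sf) _.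
exact: local_dom_chart.
Qed.

End LocalExpression.

Section Tangent.
Variable R : realType.

Lemma smooth_map_id n (M : manifold R n) : smooth_map (@idfun M).
Proof. by split=> [x|a b]; [exact: cvg_id|exact: transition_smooth]. Qed.

(** The composite through [b] agrees with the direct expression near [chart a x], which suffices for
    the differentials. Since [of_chart], [to_chart] and [differential] are differentials of local
    expressions by conversion, their transformation laws are instances. *)
Lemma diff_local_expr_comp n m q (N : manifold R n) (M : manifold R m) (P : manifold R q)
    (f : N -> M) (g : M -> P) (a : atlas N) (b : atlas M) (c : atlas P) x z :
  smooth_map f -> smooth_map g -> dom a x -> dom b (f x) -> dom c (g (f x)) ->
  'd (local_expr (g \o f) a c) (chart a x) z =
  'd (local_expr g b c) (chart b (f x)) ('d (local_expr f a b) (chart a x) z).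
Proof.
move=> sf sg ax bx cx.
have df := differentiable_local_expr sf ax bx.
have dg := differentiable_local_expr sg bx cx.
have E : local_expr f a b (chart a x) = chart b (f x) by rewrite local_expr_chart.
have := differentiable_comp df; rewrite E => /(_ _ _ dg) dgf.
have H : \forall u \near chart a x, (local_expr g b c \o local_expr f a b) u =
    local_expr (g \o f) a c u.
  have [cf _] := sf.
  have := open_nbhs_nbhs (conj (local_dom_open (a := a) (b := b) cf) (local_dom_chart ax bx)).
  apply: filterS => u /local_domP[au bu _].
  by rewrite /local_expr /= chartK.
have [_ ->] := near_eq_differentiable H dgf.
by have /= -> := diff_comp df; rewrite E.
Qed.

Variables (n : nat) (M : manifold R n).

Lemma diff_local_expr_id (a : atlas M) x z : dom a x ->
  'd (local_expr (@idfun M) a a) (chart a x) z = z.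
Proof.
move=> ax; have did : differentiable (@idfun 'rV[R]_n) (chart a x) by [].
have H : \forall u \near chart a x, idfun u = local_expr (@idfun M) a a u.
  have := open_nbhs_nbhs (conj (@codom_open _ _ M a) (ex_intro2 _ _ x ax erefl)).
  by apply: filterS => u /chart_invK[_]; rewrite /local_expr /= => ->.
have [_ ->] := near_eq_differentiable H did.
by rewrite diff_val.
Qed.

Lemma of_chartE (a b : atlas M) x v : dom a x -> dom b x ->
  of_chart a x v = of_chart b x ('d (local_expr (@idfun M) a b) (chart a x) v).
Proof.
move=> ax bx.
exact: (diff_local_expr_comp v (smooth_map_id M) (smooth_map_id M) ax bx (chart_atP x)).
Qed.

Lemma to_chartE (a b : atlas M) x v : dom a x -> dom b x ->
  to_chart b x v = 'd (local_expr (@idfun M) a b) (chart a x) (to_chart a x v).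
Proof.
move=> ax bx.
exact: (diff_local_expr_comp v (smooth_map_id M) (smooth_map_id M) (chart_atP x) ax bx).
Qed.

Lemma to_chartK (a : atlas M) x v : dom a x -> of_chart a x (to_chart a x v) = v.
Proof.
move=> ax; rewrite -[RHS](diff_local_expr_id v (chart_atP x)).
exact: (esym (diff_local_expr_comp v (smooth_map_id M) (smooth_map_id M)
  (chart_atP x) ax (chart_atP x))).
Qed.

Lemma of_chart_at x (v : 'rV[R]_n) : of_chart (@chart_at _ _ M x) x v = v.
Proof. exact: (diff_local_expr_id v (chart_atP x)). Qed.

Lemma of_chart_linear (a : atlas M) x c v w :
  of_chart a x (c *: v + w) = c *: of_chart a x v + of_chart a x w.
Proof. exact: linearP. Qed.

Lemma to_chart_linear (a : atlas M) x c v w :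
  to_chart a x (c *: v + w) = c *: to_chart a x v + to_chart a x w.
Proof. exact: linearP. Qed.

End Tangent.

Lemma differential_of_chart (R : realType) n m (N : manifold R n) (M : manifold R m)
    (f : N -> M) (a : atlas N) (b : atlas M) y z : smooth_map f -> dom a y -> dom b (f y) ->
  differential f y (of_chart a y z) = of_chart b (f y) ('d (local_expr f a b) (chart a y) z).
Proof.
move=> sf ay bfy.
transitivity ('d (local_expr f a (chart_at (f y))) (chart a y) z).
  exact: (esym (diff_local_expr_comp z (smooth_map_id N) sf ay (chart_atP y) (chart_atP (f y)))).
exact: (diff_local_expr_comp z sf (smooth_map_id M) ay bfy (chart_atP (f y))).
Qed.

(** * Forms and vector fields on a manifold *)

Section Forms.
Variables (R : realType) (m : nat) (M : manifold R m).

Lemma is_form_multilinear p (alpha : tensor M p) a u : is_form alpha ->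
  multilinear (in_chart alpha a u).
Proof.
move=> [la _ _] i v c w z; rewrite /in_chart.
have E t : (fun j => of_chart a (chart_inv a u) ([eta v with i |-> t] j)) =
    [eta (fun j => of_chart a (chart_inv a u) (v j)) with i |->
      of_chart a (chart_inv a u) t].
  by apply/funext => j /=; case: eqP.
by rewrite !E of_chart_linear la.
Qed.

Lemma is_form_alternating p (alpha : tensor M p) a u : is_form alpha ->
  Defs.alternating (in_chart alpha a u).
Proof. by move=> [_ aa _] v i j ij vij; apply: (aa _ _ i j ij); rewrite vij. Qed.

Lemma is_form_smooth p (alpha : tensor M p) a w : is_form alpha ->
  smooth_on (chart a @` dom a) ((in_chart alpha a)^~ w).
Proof. by move=> [_ _]; exact. Qed.

Lemma is_form_differentiable p (alpha : tensor M p) (a : atlas M) w x : is_form alpha ->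
  dom a x -> differentiable ((in_chart alpha a)^~ w) (chart a x).
Proof.
by move=> fa ax; apply: smooth_on_differentiable (is_form_smooth a w fa) _; exists x.
Qed.

Lemma in_chart_base p (alpha : tensor M p) x w :
  in_chart alpha (chart_at x) (base x) w = alpha x w.
Proof.
rewrite /in_chart /base (chartK (chart_atP x)); congr (alpha x).
by apply/funext => j; exact: of_chart_at.
Qed.

Lemma in_chart_chart p (alpha : tensor M p) (a : atlas M) x w : dom a x ->
  in_chart alpha a (chart a x) w = alpha x (fun j => of_chart a x (w j)).
Proof. by move=> ax; rewrite /in_chart chartK. Qed.

Lemma codom_nbhs (a : atlas M) x : dom a x -> nbhs (chart a x) (chart a @` dom a).
Proof. by move=> ax; apply: open_nbhs_nbhs; split; [exact: codom_open|exists x]. Qed.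

Lemma in_chart_change p (alpha : tensor M p) (a b : atlas M) u w :
  local_dom (@idfun M) a b u ->
  in_chart alpha a u w = in_chart alpha b (local_expr (@idfun M) a b u)
    (fun j => 'd (local_expr (@idfun M) a b) u (w j)).
Proof.
move=> /local_domP[]; move: (chart_inv a u) => x /= ax bx xu.
rewrite -xu local_expr_chart // /in_chart /= !chartK //; congr (alpha x).
by apply/funext => j; exact: of_chartE.
Qed.

(** At each point [ext_d] uses the chart chosen there; naturality under the transition map to that
    chart gives the same value in the fixed chart [a]. This is what allows [ext_d alpha] to be
    differentiated again. *)
Lemma in_chart_ext_d p (alpha : tensor M p) (a : atlas M) u w : is_form alpha ->
  (chart a @` dom a) u -> in_chart (ext_d alpha) a u w = local_d (in_chart alpha a) u w.
Proof.
move=> fa [x ax <-].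
have cx := chart_atP x.
have [c0 _] := smooth_map_id M.
have Uo := local_dom_open (a := a) (b := chart_at x) c0.
have Ux := local_dom_chart ax (cx : dom (chart_at x) (idfun x)).
have E : local_expr (@idfun M) a (chart_at x) (chart a x) = base x.
  by rewrite local_expr_chart.
rewrite {1}/in_chart chartK //.
have := @local_d_pullback _ _ _ _ _ _ Uo (smooth_local_expr a (chart_at x) (smooth_map_id M)) Ux
  p (in_chart alpha (chart_at x)) w (fun y => is_form_multilinear _ y fa)
  (is_form_alternating _ _ fa).
rewrite E => /(_ (fun w => is_form_differentiable w fa cx)) H.
apply: etrans (esym H) _.
apply: eq_local_d; apply: filterS (open_nbhs_nbhs (conj Uo Ux)) => t Ut v.
by rewrite (in_chart_change _ _ Ut).
Qed.

Lemma ext_d_ext_d p (alpha : tensor M p) : is_form alpha -> ext_d (ext_d alpha) = 0.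
Proof.
move=> fa; apply/funext => x; apply/funext => v.
apply: etrans (local_d_local_d v (codom_open (a := chart_at x))
  (ex_intro2 _ _ x (chart_atP x) erefl) (fun w => is_form_smooth (chart_at x) w fa)).
apply: eq_local_d; apply: filterS (codom_nbhs (chart_atP x)) => u Uu w.
exact: in_chart_ext_d.
Qed.

Lemma is_formD p (alpha beta : tensor M p) : is_form alpha -> is_form beta ->
  is_form (alpha + beta).
Proof.
move=> [la aa sa] [lb ab sb]; split.
- by move=> x i v c u w; rewrite !addrfctE la lb mulrDr addrACA.
- by move=> x v i j ij vij; rewrite !addrfctE (aa _ _ i j) // (ab _ _ i j) // addr0.
- by move=> a w; exact: (smooth_onD (codom_open (a := a)) (sa a w) (sb a w)).
Qed.

Lemma is_formZ p c (alpha : tensor M p) : is_form alpha -> is_form (c *: alpha).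
Proof.
move=> [la aa sa]; split.
- move=> x i v d u w.
  rewrite -![(c *: alpha) x _]/(c * alpha x _) la; ring.
- move=> x v i j ij vij.
  by rewrite -[LHS]/(c * alpha x v) (aa _ _ i j) // mulr0.
- by move=> a w; exact: (smooth_onZ (codom_open (a := a)) c (sa a w)).
Qed.

Lemma ext_dZ p c (alpha : tensor M p) : is_form alpha ->
  ext_d (c *: alpha) = c *: ext_d alpha.
Proof.
move=> fa; apply/funext => x; apply/funext => v.
rewrite -[RHS]/(c * ext_d alpha x v) /ext_d mulr_sumr; apply: eq_bigr => j _.
rewrite mulrCA; congr (_ * _).
have dA := is_form_differentiable (fun i => v (lift j i)) fa (chart_atP x).
exact: (deriveZ c (diff_derivable dA)).
Qed.

Definition chart_field (X : M -> 'rV[R]_m) (a : atlas M) (u : 'rV[R]_m) : 'rV[R]_m :=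
  to_chart a (chart_inv a u) (X (chart_inv a u)).

Lemma chart_field_chart X (a : atlas M) x : dom a x ->
  chart_field X a (chart a x) = to_chart a x (X x).
Proof. by move=> ax; rewrite /chart_field chartK. Qed.

Lemma in_chart_contract p X (alpha : tensor M p.+1) a u w : (chart a @` dom a) u ->
  in_chart (Defs.contract X alpha) a u w =
  local_contract (chart_field X a) (in_chart alpha a) u w.
Proof.
move=> /chart_invK[au _]; rewrite /in_chart /Defs.contract /local_contract.
congr (alpha _); apply/funext => j; rewrite /tcons /chart_field.
by case: unlift => //; rewrite to_chartK.
Qed.

(** For smoothness, the first argument is expanded in the standard basis: the coordinates of [X] and
    the values of [alpha] on fixed vectors are smooth. *)
Lemma is_form_contract p X (alpha : tensor M p.+1) : smooth_field X -> is_form alpha ->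
  is_form (Defs.contract X alpha).
Proof.
move=> sX fa; have [la aa _] := fa; split.
- by move=> x; exact: multilinear_tail.
- by move=> x; exact: alternating_tail.
- move=> a w; pose A := in_chart alpha a.
  apply: (@eq_smooth_on _ _ _ (codom_open (a := a)) _
    (fun u => \sum_j chart_field X a u 0 j * A u (tcons (delta_mx 0 j) w))).
    move=> u; rewrite inE => Uu.
    rewrite in_chart_contract // /local_contract.
    by rewrite (linear_expand (multilinear_head w (is_form_multilinear a u fa))).
  apply: (smooth_on_comb (codom_open (a := a)) (sX a)) => j.
  exact: is_form_smooth.
Qed.

Lemma chart_field_change X (a b : atlas M) u : local_dom (@idfun M) a b u ->
  chart_field X b (local_expr (@idfun M) a b u) =
  'd (local_expr (@idfun M) a b) u (chart_field X a u).
Proof.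
move=> [x [ax bx] <-].
rewrite local_expr_chart // !chart_field_chart //.
exact: to_chartE.
Qed.

Definition bracket (X Y : M -> 'rV[R]_m) (x : M) : 'rV[R]_m :=
  local_bracket (chart_field X (chart_at x)) (chart_field Y (chart_at x)) (base x).

Lemma differentiable_chart_field X (a : atlas M) x : smooth_field X -> dom a x ->
  differentiable (chart_field X a) (chart a x).
Proof. by move=> sX ax; apply: smooth_on_differentiable (sX a) _; exists x. Qed.

(** Counterpart of [in_chart_ext_d] for the bracket: the expressions of a field in two charts are
    related by the transition map. *)
Lemma chart_field_bracket X Y (a : atlas M) u : smooth_field X -> smooth_field Y ->
  (chart a @` dom a) u ->
  chart_field (bracket X Y) a u = local_bracket (chart_field X a) (chart_field Y a) u.
Proof.
move=> sX sY [x ax <-]; rewrite chart_field_chart //.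
have cx := chart_atP x.
have [c0 _] := smooth_map_id M.
have Uo := local_dom_open (a := chart_at x) (b := a) c0.
have Ux := local_dom_chart cx (ax : dom a (idfun x)).
have E : local_expr (@idfun M) (chart_at x) a (chart (chart_at x) x) = chart a x.
  by rewrite local_expr_chart.
have := @local_bracket_related _ _ _ _ _ _ Uo
  (smooth_local_expr (chart_at x) a (smooth_map_id M)) Ux
  (chart_field X (chart_at x)) (chart_field Y (chart_at x))
  (chart_field X a) (chart_field Y a)
  (fun y => @chart_field_change X _ _ y) (fun y => @chart_field_change Y _ _ y)
  (differentiable_chart_field sX cx) (differentiable_chart_field sY cx).
rewrite E => /(_ (differentiable_chart_field sX ax) (differentiable_chart_field sY ax)) H.
exact: esym H.
Qed.

Lemma smooth_bracket X Y : smooth_field X -> smooth_field Y -> smooth_field (bracket X Y).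
Proof.
move=> sX sY a; have Uo := codom_open (a := a).
apply: (eq_smooth_on Uo _ (smooth_on_local_bracket Uo (sX a) (sY a))) => u.
by rewrite inE => Uu; rewrite -chart_field_bracket.
Qed.

Lemma ext_d_contract2 p (X Y : M -> 'rV[R]_m) (omega : tensor M p.+2) :
  is_form omega -> ext_d omega = 0 -> smooth_field X -> smooth_field Y ->
  ext_d (Defs.contract X omega) = 0 -> ext_d (Defs.contract Y omega) = 0 ->
  ext_d (Defs.contract X (Defs.contract Y omega)) = Defs.contract (bracket X Y) omega.
Proof.
move=> fo o0 sX sY X0 Y0; apply/funext => x; apply/funext => w.
have cx := chart_atP x.
set c := chart_at x in cx; pose A := in_chart omega c.
have nearc := codom_nbhs cx.
have contractE Z w' : local_d (in_chart (Defs.contract Z omega) c) (base x) w' =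
    local_d (local_contract (chart_field Z c) A) (base x) w'.
  by apply: eq_local_d; apply: filterS nearc => u Uu v; exact: in_chart_contract.
have dA v w' : derivable (A^~ w') (base x) v.
  exact: diff_derivable (is_form_differentiable w' fo cx).
have := local_d_contract2 (p := p) (X := chart_field X c)
  (Y := chart_field Y c) (A := A) (u := base x) w
  (fun y => is_form_multilinear c y fo) (is_form_alternating c _ fo) dA
  (fun v => diff_derivable (differentiable_chart_field sX cx))
  (fun v => diff_derivable (differentiable_chart_field sY cx))
  (fun w' => congr1 (fun t : tensor M p.+3 => t x w') o0)
  (fun w' => etrans (esym (contractE X w')) (congr1 (fun t : tensor M p.+2 => t x w') X0))
  (fun w' => etrans (esym (contractE Y w')) (congr1 (fun t : tensor M p.+2 => t x w') Y0)).
(* At [base x] the chart [chart_at x] reads tangent vectors as they are, so the right-hand side is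
   [omega x] on [bracket X Y x] and [w]. *)
rewrite [RHS]in_chart_base => H.
apply: etrans H; apply: eq_local_d; apply: filterS nearc => u Uu v.
by rewrite in_chart_contract // /local_contract in_chart_contract.
Qed.

End Forms.

(** * Pullback along a smooth map *)

Section Pullback.
Variables (R : realType) (n m : nat) (N : manifold R n) (M : manifold R m).
Variable f : N -> M.

Lemma in_chart_pullback p (alpha : tensor M p) (a : atlas N) (b : atlas M) u w :
  smooth_map f -> local_dom f a b u ->
  in_chart (pullback f alpha) a u w = in_chart alpha b (local_expr f a b u)
    (fun j => 'd (local_expr f a b) u (w j)).
Proof.
move=> sf [y [ay by_] <-].
rewrite in_chart_chart // local_expr_chart // in_chart_chart //.
congr (alpha _); apply/funext => j.
exact: (differential_of_chart _ sf ay by_).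
Qed.

Lemma pullback_ext_d p (alpha : tensor M p) :
  smooth_map f -> is_form alpha -> pullback f (ext_d alpha) = ext_d (pullback f alpha).
Proof.
move=> sf fa; apply/funext => y; apply/funext => w.
have cy := chart_atP y; have cfy := chart_atP (f y).
have [cf _] := sf.
have Uo := local_dom_open (a := chart_at y) (b := chart_at (f y)) cf.
have Uy := local_dom_chart cy cfy.
have E : local_expr f (chart_at y) (chart_at (f y)) (chart (chart_at y) y) = base (f y).
  by rewrite local_expr_chart.
have := @local_d_pullback _ _ _ _ _ _ Uo (smooth_local_expr (chart_at y) (chart_at (f y)) sf) Uy
  p (in_chart alpha (chart_at (f y))) w (fun y => is_form_multilinear _ y fa)
  (is_form_alternating _ _ fa).
rewrite E => /(_ (fun w => is_form_differentiable w fa cfy)) H.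
apply: etrans (esym H) _.
apply: eq_local_d; apply: filterS (open_nbhs_nbhs (conj Uo Uy)) => u Uu v.
exact: esym (in_chart_pullback _ _ sf Uu).
Qed.

End Pullback.

(** * Hamiltonian forms and their classes *)

Section HamiltonianForms.
Variables (R : realType) (m p : nat) (M : manifold R m) (omega : tensor M p.+2).
Hypothesis fo : is_form omega.

Lemma ext_d0 q : ext_d (0 : tensor M q) = 0.
Proof. by have [] := closed_forms0 M q. Qed.

Lemma hamiltonian_field0 : hamiltonian_field omega 0 (fun=> 0).
Proof.
split.
  move=> a; apply: (eq_smooth_on (codom_open (a := a)) _ (smooth_on_cst _ 0)).
  by move=> u _; rewrite [RHS]linear0.
rewrite ext_d0; apply/funext => x; apply/funext => w.
by rewrite /Defs.contract -(tcons_upd0 0) multilinear0 //; have [+ _ _] := fo.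
Qed.

Lemma hamiltonian_fieldP c alpha beta X Y : is_form alpha -> is_form beta ->
  hamiltonian_field omega alpha X -> hamiltonian_field omega beta Y ->
  hamiltonian_field omega (c *: alpha + beta) (fun x => c *: X x + Y x).
Proof.
move=> fa fb [sX dX] [sY dY]; split.
  move=> a; have Uo := codom_open (a := a).
  apply: (eq_smooth_on Uo _ (smooth_onD Uo (smooth_onZ Uo c (sX a)) (sY a))).
  by move=> u _; rewrite to_chart_linear.
rewrite ext_dD //; last exact: is_formZ.
rewrite ext_dZ // -dX -dY; apply/funext => x; apply/funext => w.
by have [lo _ _] := fo; rewrite /Defs.contract (multilinear_head _ (lo x)).
Qed.

Lemma closed_formsP q c (alpha beta : tensor M q) :
  closed_forms M q alpha -> closed_forms M q beta -> closed_forms M q (c *: alpha + beta).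
Proof.
move=> [fa da] [fb db]; have fca := is_formZ c fa; split; first exact: is_formD.
by rewrite ext_dD // ext_dZ // da db scaler0 addr0.
Qed.

Lemma hat_addE (alpha beta : tensor M p) :
  hat_add (hat alpha) (hat beta) = hat (alpha + beta).
Proof.
apply/seteqP; split=> [_ [_ [z cz <-] [_ [z' cz' <-] <-]]|_ [z cz <-]].
  exists (z + z'); last by rewrite addrACA.
  by rewrite -[z]scale1r; exact: closed_formsP.
exists (alpha + z); first by exists z.
exists (beta + 0); first by exists 0 => //; exact: closed_forms0.
by rewrite addr0 addrAC.
Qed.

(** The closed summand in [hat_scale] matters for [c = 0], where the multiples of the members of a
    coset reduce to the zero form. *)
Lemma hat_scaleE c (alpha : tensor M p) :
  hat_scale c (hat alpha) = hat (c *: alpha).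
Proof.
apply/seteqP; split=> [_ [_ [z cz <-] [z' cz' <-]]|_ [z cz <-]].
  by exists (c *: z + z'); [exact: closed_formsP|rewrite scalerDr addrA].
exists (alpha + 0); first by exists 0 => //; exact: closed_forms0.
by exists z => //; rewrite addr0.
Qed.

Lemma contract2_form (X Y : M -> 'rV[R]_m) : smooth_field X -> smooth_field Y ->
  is_form (contract2 X Y omega).
Proof. by move=> sX sY; exact: is_form_contract sY (is_form_contract sX fo). Qed.

(** [- contract2 X Y omega] equals [contract2 Y X omega], which unfolds to iota_X iota_Y omega; so
    the sign in the definition of the bracket of classes gives [X, Y] itself as a Hamiltonian
    field. *)
Lemma contract2_hamiltonian alpha beta (X Y : M -> 'rV[R]_m) : ext_d omega = 0 ->
  is_form alpha -> is_form beta ->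
  hamiltonian_field omega alpha X -> hamiltonian_field omega beta Y ->
  hamiltonian_field omega (- contract2 X Y omega) (bracket X Y).
Proof.
move=> o0 fa fb [sX dX] [sY dY]; split; first exact: smooth_bracket.
rewrite -contract2C // -ext_d_contract2 // ?dX ?dY; exact: ext_d_ext_d.
Qed.

End HamiltonianForms.

(** * Use of coisotropy, and closure under the bracket *)

Section Coisotropic.
Variables (R : realType) (m n p : nat) (M : manifold R m) (N : manifold R n).
Variables (omega : tensor M p.+2) (i : N -> M).

Lemma pullback_contract2 alpha beta (X Y : M -> 'rV[R]_m) :
  is_form omega -> coisotropic omega i ->
  hamiltonian_field omega alpha X -> hamiltonian_field omega beta Y ->
  pullback i (ext_d alpha) = 0 -> pullback i (ext_d beta) = 0 ->
  pullback i (contract2 X Y omega) = 0.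
Proof.
move=> [lo ao _] co [_ dX] [_ dY] a0 b0; apply/funext => y; apply/funext => w.
rewrite /pullback /contract2 -[RHS]/(0 : R).
(* Applied to [X] to feed coisotropy, and to [Y] on a tuple beginning with [t]. Preimages of the
   vectors [W j] under the differential of [i] are chosen so that the pullback can be evaluated. *)
have van Z (gamma : tensor M p) W : Defs.contract Z omega = ext_d gamma ->
    pullback i (ext_d gamma) = 0 -> (forall j, tangent_image i y (W j)) ->
    omega (i y) (tcons (Z (i y)) W) = 0.
  move=> dZ g0 TW; have {}TW j : exists v, differential i y v = W j.
    by have [v _ <-] := TW j; exists v.
  have [v vW] := choice TW.
  rewrite -[LHS]/(Defs.contract Z omega (i y) W) dZ.
  transitivity (pullback i (ext_d gamma) y v); last by rewrite g0.
  by congr (ext_d gamma _); apply/funext => j; rewrite vW.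
have [t Tt [c kc Xtc]] : exists2 t, tangent_image i y t & exists2 c,
    flat_kernel omega (i y) c & t + c = X (i y).
  by apply: (co y) => W TW; exact: van dX a0 TW.
(* The kernel vector [c] annihilates [omega] on arbitrary remaining arguments, including [Y (i y)],
   which may fail to be tangent to [N]. *)
rewrite -Xtc addrC -[c]scale1r (multilinear_head _ (lo _)) kc mulr0 add0r.
(* With [Y (i y)] in front, all remaining arguments, [t] and the images of [w], are tangent to
   [N]. *)
rewrite alternating_swap0 // (van _ _ _ dY b0) ?oppr0 // => j.
by rewrite /tcons; case: unliftP => [k|] _ //; exists (w k).
Qed.

End Coisotropic.

Theorem proposition3p1p2 (R : realType) (m n p : nat)
    (M : manifold R m) (N : manifold R n)
    (omega : tensor M p.+2) (i : N -> M)
    (omega_multisymplectic : multisymplectic omega)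
    (i_submanifold : submanifold i)
    (i_coisotropic : coisotropic omega i) :
  lie_subalgebra omega (hat_vanishing omega i).
Proof.
have [fo o0] := omega_multisymplectic.
have [si _ _] := i_submanifold.
(* One combination serves both linear operations: [c = 1] gives sums and [beta = 0] gives
   multiples. *)
have comb c alpha beta :
    hamiltonian_forms omega alpha -> pullback i (ext_d alpha) = 0 ->
    hamiltonian_forms omega beta -> pullback i (ext_d beta) = 0 ->
    hat_vanishing omega i (hat (c *: alpha + beta)).
  move=> [fa [X hX]] a0 [fb [Y hY]] b0; exists (c *: alpha + beta) => //; split.
    split; first by apply: is_formD => //; exact: is_formZ.
    by exists (fun x => c *: X x + Y x); exact: hamiltonian_fieldP.
  rewrite ext_dD //; last exact: is_formZ.
  rewrite ext_dZ //; apply/funext => y; apply/funext => w.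
  transitivity (c * pullback i (ext_d alpha) y w + pullback i (ext_d beta) y w) => //.
  by rewrite a0 b0 -[LHS]/(c * 0 + 0) mulr0 addr0.
have H0 : hamiltonian_forms omega 0.
  split; first by have [] := closed_forms0 M p.
  by exists (fun=> 0); exact: hamiltonian_field0.
have i0 : pullback i (ext_d (0 : tensor M p)) = 0 by rewrite ext_d0.
split.
- by move=> _ [alpha [ha _] <-]; exists alpha.
- by exists 0.
- move=> _ _ [alpha [ha a0] <-] [beta [hb b0] <-].
  by rewrite hat_addE -[alpha]scale1r; exact: comb.
- move=> c _ [alpha [ha a0] <-].
  by rewrite hat_scaleE -[c *: alpha]addr0; exact: comb.
- move=> _ _ [alpha [[fa [X hX]] a0] <-] [beta [[fb [Y hY]] b0] <-].
  (* The union over all representatives and Hamiltonian fields collapses to one coset, so a single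
     form has to be checked. *)
  rewrite (hat_bracketE fo fa fb hX hY).
  have fXY := contract2_form fo hX.1 hY.1.
  exists (- contract2 X Y omega) => //; split; [split|].
  + by rewrite -scaleN1r; exact: is_formZ.
  + by exists (bracket X Y); exact: contract2_hamiltonian hX hY.
  + rewrite -scaleN1r ext_dZ //; apply/funext => y; apply/funext => w.
    transitivity (-1 * pullback i (ext_d (contract2 X Y omega)) y w) => //.
    rewrite pullback_ext_d // (pullback_contract2 _ _ hX hY) // ext_d0.
    exact: mulr0.
Qed.
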